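(* Let $p\in[2,3)$ and fix an interval $I\subseteq[0,T]$. Let $\mathbf A=(A^1,A^2)$ be a continuous unbounded $p$-rough driver on $I$ with respect to a scale $(E_n)_{0\le n\le 3}$ endowed with a smoothing $(J^\eta)_{\eta\in(0,1)}$, and let $\omega_A$ be a regular control satisfying the driver bounds $$\|A^1_{st}\|^p_{\mathcal L(E_{-n},E_{-(n+1)})}\le\omega_A(s,t)\ (n\in\{0,2\}),\qquad \|A^2_{st}\|^{p/2}_{\mathcal L(E_{-n},E_{-(n+2)})}\le\omega_A(s,t)\ (n\in\{0,1\}).$$ Consider a path $\mu\in\overline V^1_1(I;E_{-3})$ for which there exist two controls $\omega^1_\mu,\omega^2_\mu$ and a constant $\lambda\in[p,3]$ such that for every $\varphi\in E_3$, $s<t\in I$, $\eta\in(0,1)$ and $k\in\{1,2\}$, $$|(\delta\mu)_{st}(J^\eta\varphi)|\le \omega^1_\mu(s,t)\,\|\varphi\|_{E_1}+\eta^{k-\lambda}\,\omega^2_\mu(s,t)\,\|\varphi\|_{E_k}.$$ Let $g:I\to E_{-0}$ be a solution on $I$ of $\mathrm dg_t=\mu(\mathrm dt)+\mathbf A(\mathrm dt)g_t$, that is, for all $s<t\in I$ and $\varphi\in E_3$, $$(\delta g)_{st}(\varphi)=(\delta\mu)_{st}(\varphi)+g_s\big(\{A^{1,*}_{st}+A^{2,*}_{st}\}\varphi\big)+g^\natural_{st}(\varphi),$$ such that $g^\natural\in V^{q/3}_2(I;E_{-3})$ for some parameter $$q\in\Big[\frac{3p\lambda}{2p+\lambda},3\Big).$$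 Let $G_{st}=\|g\|_{L^\infty(s,t;E_{-0})}$, fix $\kappa\in[0,\tfrac1p)$ such that $$\frac12\Big(\frac3p-\frac3q\Big)\ \ge\ \kappa\ \ge\ \frac{1}{\lambda-2}\Big(\frac3q-1-\frac{3-\lambda}{p}\Big)$$ (when $\lambda=2$ the second inequality is read as $\kappa(\lambda-2)\ge \frac3q-1-\frac{3-\lambda}{p}$), and set $$\omega_*(s,t):=G_{st}^{\frac q3}\,\omega_A(s,t)^{\frac q3(\frac3p-2\kappa)}+\omega^1_\mu(s,t)^{\frac q3}\,\omega_A(s,t)^{\frac{q}{3p}}+\omega^2_\mu(s,t)^{\frac q3}\,\omega_A(s,t)^{\frac q3\left(\frac{3-\lambda}{p}+\kappa(\lambda-2)\right)}.$$ Then there exists a constant $L=L(p,q,\kappa)>0$ such that if $\omega_A(I)\le L$, one has, for all $s<t\in I$, $$\|g^\natural_{st}\|_{E_{-3}}\lesssim_q \omega_*(s,t)^{\frac3q}.$$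
   Context: Increments: $\delta g_{st}=g_t-g_s$ for a path $g$; $\delta g_{sut}=g_{st}-g_{su}-g_{ut}$ for a two-index map $g$. The relation $a\lesssim_x b$ means $a\le c_x b$ for a constant $c_x$ depending on the parameter $x$; $a\lesssim b$ means the same with some fixed constant. Constants are allowed to depend on the fixed implicit constants in the smoothing estimates below. Controls: for an interval $I$, a control on $I$ is a map $\omega:\{(s,t)\in I^2:s\le t\}\to[0,\infty)$ with $\omega(s,u)+\omega(u,t)\le\omega(s,t)$ for $s\le u\le t$. It is regular if $\lim_{|t-s|\to0}\omega(s,t)=0$. For $I=[a,b]$, $\omega(I):=\omega(a,b)$. Spaces: for a Banach space $E$, $\overline V^1_1(I;E)$ is the space of paths $I\to E$ of finite $1$-variation. For $r>0$, $V^r_2(I;E)$ is the set of two-index maps $g:I\times I\to E$ with left and right limits in each variable for which there is a regular control $\omega$ with $\|g_{st}\|\le\omega(s,t)^{1/r}$ for all $s\le t$ in $I$. Scale: a family $(E_n,\|\cdot\|_n)_{0\le n\le3}$ of Banach spaces with $E_{n+1}$ continuously embedded in $E_n$; $E_{-n}$ is the topological dual of $E_n$ (so $E_{-0}$ is the dual of $E_0$). Continuous unbounded $p$-rough driver on $I$ with respect to $(E_n)$: a pair $\mathbf A=(A^1,A^2)$ of two-index maps with $A^1_{st}\in\mathcal L(E_{-n},E_{-(n+1)})$ for $n\in\{0,2\}$, $A^2_{st}\in\mathcal L(E_{-n},E_{-(n+2)})$ for $n\in\{0,1\}$, for which there is a regular control $\omega_A$ such that for all $s\le t$ in $I$ the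 two bounds displayed in the claim hold, and which satisfies Chen's relation $\delta A^1_{sut}=0$, $\delta A^2_{sut}=A^1_{ut}A^1_{su}$ for $s<u<t$. Here $A^{1,*}_{st}:E_{n+1}\to E_n$ ($n\in\{0,2\}$) and $A^{2,*}_{st}:E_{n+2}\to E_n$ ($n\in\{0,1\}$) denote the corresponding operators on test functions, whose adjoints are $A^1_{st}$, $A^2_{st}$ (compatible with the embeddings of the scale), so that $(A^j_{st}g)(\varphi)=g(A^{j,*}_{st}\varphi)$; Chen's relation reads $\delta A^{2,*}_{sut}\varphi=A^{1,*}_{su}A^{1,*}_{ut}\varphi$ for $\varphi\in E_3$. Smoothing on $(E_n)_{0\le n\le3}$: a family of operators $(J^\eta)_{\eta\in(0,1)}$ acting on $E_n$ (for $n=1,2$) such that $\|J^\eta-\mathrm{Id}\|_{\mathcal L(E_m,E_n)}\lesssim\eta^{m-n}$ for $(n,m)\in\{(0,1),(0,2),(1,2)\}$ and $\|J^\eta\|_{\mathcal L(E_n,E_m)}\lesssim\eta^{-(m-n)}$ for $(n,m)\in\{(1,1),(1,2),(2,2),(1,3),(2,3)\}$, with implicit constants independent of $\eta$.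
   Formalization: The constant in the estimate and L may depend, besides the stated parameters and the smoothing constants, on the norms of the embeddings of E_{n+1} in E_n (without this the claim fails); the L^∞ norm of g is the supremum over the closed interval [s,t]. *)

(* Defs.v *)
From HB Require Import structures.
From mathcomp Require Import all_boot all_order all_algebra.
From mathcomp Require Import all_classical all_reals all_analysis.

Set Implicit Arguments.
Unset Strict Implicit.
Unset Printing Implicit Defensive.

Import Order.TTheory GRing.Theory Num.Theory.
Import numFieldNormedType.Exports.

Local Open Scope classical_set_scope.
Local Open Scope ring_scope.

Section BoundedOperators.
Context {R : realType} {V W : normedModType R}.

Definition bounded_op : {pred V -> W} :=
  [pred f | `[< linear f /\ continuous f >]].

Record bop := Bop { bop_fun :> V -> W ; _ : bop_fun \in bounded_op }.

HB.instance Definition _ := [isSub for bop_fun].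
HB.instance Definition _ := [Choice of bop by <:].

Lemma bop_linear (f : bop) : linear f.
Proof. by have /asboolP[] := valP f. Qed.

Lemma bop_continuous (f : bop) : continuous f.
Proof. by have /asboolP[] := valP f. Qed.

HB.instance Definition _ (f : bop) :=
  GRing.isLinear.Build R V W *:%R (bop_fun f) (bop_linear f).

Lemma bounded_op_submod : submod_closed bounded_op.
Proof.
split=> [|c f g /asboolP[lf cf] /asboolP[lg cg]]; apply/asboolP; split.
- by move=> a u v; rewrite -[LHS]/0 -[RHS]/(a *: 0 + 0) scaler0 addr0.
- by move=> x; exact: cvg_cst.
- move=> a u v; pose h x := c *: f x + g x; rewrite -[LHS]/(h _).
  by rewrite -[RHS]/(a *: h u + h v) /h lf lg !scalerDr !scalerA mulrC addrACA.
- by move=> x; apply: cvgD; [apply: cvgZr; exact: cf|exact: cg].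
Qed.

HB.instance Definition _ :=
  GRing.isSubmodClosed.Build R (V -> W) bounded_op bounded_op_submod.
HB.instance Definition _ := [SubChoice_isSubLmodule of bop by <:].

Definition opnorm (f : bop) : R := sup [set `|f x| | x in [set x | `|x| <= 1]].

Lemma bopDE (f g : bop) x : (f + g) x = f x + g x.
Proof. by []. Qed.

Lemma bopZE c (f : bop) x : (c *: f) x = c *: f x.
Proof. by []. Qed.

Let unit_ne (f : bop) : [set `|f x| | x in [set x | `|x| <= 1]] !=set0.
Proof. by exists `|f 0|; exists 0 => //=; rewrite normr0. Qed.

Let unit_sup (f : bop) : has_sup [set `|f x| | x in [set x | `|x| <= 1]].
Proof.
split; first exact: unit_ne.
have /linear_boundedP : bounded_near f (nbhs (0 : V)).
  by apply/linear_bounded_continuous; exact: bop_continuous.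
move=> /pinfty_ex_gt0[c c0 fc]; exists c => _ [x /= x1 <-].
by rewrite (le_trans (fc x))// ler_piMr// ltW.
Qed.

Let opnorm_ub (f : bop) x : `|x| <= 1 -> `|f x| <= opnorm f.
Proof. by move=> x1; apply: (sup_upper_bound (unit_sup f)); exists x. Qed.

Let opnorm_le (f : bop) c : (forall x, `|x| <= 1 -> `|f x| <= c) ->
  opnorm f <= c.
Proof.
by move=> fc; apply: ge_sup; [exact: unit_ne|move=> _ [x /= x1 <-]; exact: fc].
Qed.

Lemma ler_opnorm (f : bop) x : `|f x| <= opnorm f * `|x|.
Proof.
have [->|x0] := eqVneq x 0; first by rewrite linear0 !normr0 mulr0.
have nx0 : 0 < `|x| by rewrite normr_gt0.
have -> : f x = `|x| *: f (`|x|^-1 *: x).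
  by rewrite linearZ scalerA divff ?scale1r// gt_eqF.
rewrite normrZ normr_id mulrC ler_pM2r//; apply: opnorm_ub.
by rewrite normrZ normfV normr_id mulVf// gt_eqF.
Qed.

Let opnorm_ge0 (f : bop) : 0 <= opnorm f.
Proof. by apply: le_trans (opnorm_ub f (x := 0) _); rewrite ?normr0. Qed.

Lemma opnormD (f g : bop) : opnorm (f + g) <= opnorm f + opnorm g.
Proof.
apply: opnorm_le => x x1; rewrite bopDE (le_trans (ler_normD _ _))//.
by rewrite lerD// opnorm_ub.
Qed.

Let opnormZ_le c (f : bop) : opnorm (c *: f) <= `|c| * opnorm f.
Proof.
by apply: opnorm_le => x x1; rewrite bopZE normrZ ler_wpM2l// opnorm_ub.
Qed.

Lemma opnormZ c (f : bop) : opnorm (c *: f) = `|c| * opnorm f.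
Proof.
have [->|c0] := eqVneq c 0.
  rewrite normr0 mul0r; apply/eqP; rewrite eq_le opnorm_ge0 andbT.
  by rewrite (le_trans (opnormZ_le 0 f))// normr0 mul0r.
apply/eqP; rewrite eq_le opnormZ_le /= -ler_pdivlMl ?normr_gt0//.
rewrite -[X in opnorm X <= _](scalerK c0) -normfV; exact: opnormZ_le.
Qed.

Lemma opnorm0_eq0 (f : bop) : opnorm f = 0 -> f = 0.
Proof.
move=> f0; apply/val_inj/funext => x /=; apply/eqP; rewrite -normr_le0.
by rewrite (le_trans (ler_opnorm f x))// f0 mul0r.
Qed.

HB.instance Definition _ :=
  Lmodule_isNormed.Build R bop opnormD opnormZ opnorm0_eq0.

End BoundedOperators.
Arguments bop {R} V W.

Notation "{ 'bounded' V -> W }" := (bop V W)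
  (at level 0, V at level 98, W at level 99, format "{ 'bounded'  V  ->  W }").

Definition dual {R : realType} (V : normedModType R) : normedModType R :=
  {bounded V -> R^o}.

(* Paths, two-index maps and controls on an interval I = `[a, b] are total
   functions on R; only their values at points of I are constrained or used. *)

Section Paths.
Context {R : realType}.
Implicit Types (a b r : R) (w : R -> R -> R).

Definition delta1 {W : zmodType} (g : R -> W) (s t : R) : W := g t - g s.

Definition delta2 {W : zmodType} (g : R -> R -> W) (s u t : R) : W :=
  g s t - g s u - g u t.

Definition control a b w : Prop :=
  (forall s t, s \in `[a, b] -> t \in `[a, b] -> s <= t -> 0 <= w s t) /\
  (forall s u t, s \in `[a, b] -> t \in `[a, b] -> s <= u -> u <= t ->
    w s u + w u t <= w s t).

Definition regular_control a b w : Prop :=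
  control a b w /\
  forall e, 0 < e -> exists2 d, 0 < d &
    forall s t, s \in `[a, b] -> t \in `[a, b] -> s <= t -> t - s < d ->
      w s t < e.

Section Normed.
Context {W : normedModType R}.

Definition finite_1variation a b (f : R -> W) : Prop :=
  exists M : R, forall p : seq R, itv_partition a b p ->
    \sum_(0 <= i < size p)
      `|f (nth b (a :: p) i.+1) - f (nth b (a :: p) i)| <= M.

Definition sided_limits a b (f : R -> W) : Prop :=
  (forall u, u \in `]a, b] -> cvg (f x @[x --> u^'-])) /\
  (forall u, u \in `[a, b[ -> cvg (f x @[x --> u^'+])).

Definition V2 r a b (g : R -> R -> W) : Prop :=
  [/\ forall s, s \in `[a, b] -> sided_limits a b (g s),
      forall t, t \in `[a, b] -> sided_limits a b (g ^~ t) &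
      exists2 w, regular_control a b w &
        forall s t, s \in `[a, b] -> t \in `[a, b] -> s <= t ->
          `|g s t| <= w s t `^ r^-1].

(* The L^oo norm of a path that is defined everywhere is the supremum of its
   norm over the closed interval; it is +oo when the path is unbounded. *)
Definition Linfty (g : R -> W) (s t : R) : \bar R :=
  ereal_sup [set `|g r|%:E | r in `[s, t]].

End Normed.
End Paths.

(* A scale consists of E 0, ..., E 3.  Indexing by nat is only a convenience:
   no condition is put on E n for 3 < n, and these spaces are never used. *)
Record scale (R : realType) := Scale {
  space :> nat -> completeNormedModType R ;
  emb : forall n, {bounded space n.+1 -> space n} ;
  emb_inj : forall n, (n < 3)%N -> injective (emb n)
}.

Section Scale.
Context {R : realType}.
Implicit Type E : scale R.

Definition emb20 E (x : E 2%N) : E 0%N := emb E 0 (emb E 1 x).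
Definition emb31 E (x : E 3%N) : E 1%N := emb E 1 (emb E 2 x).
Definition emb30 E (x : E 3%N) : E 0%N := emb E 0 (emb31 x).

(* Norms on the E n are not assumed to be increasing in n, so the constants in
   the estimates depend on the norms of the embeddings: already
   |A1s 2 s t phi|_{E 1} is only bounded through that of E 2 into E 1. *)
Definition embedding_bound E (c : R) : Prop :=
  forall n, (n < 3)%N -> forall x, `|emb E n x| <= c * `|x|.

(* Each J eta maps E 1 to E 3 by the (1, 3) estimate, so a single map determines
   its action on E 1 and, by restriction, on E 2. *)
Record smoothing_bound E (J : R -> {bounded E 1%N -> E 3%N}) (c : R) : Prop := {
  smooth_id01 : forall eta, 0 < eta < 1 -> forall x : E 1%N,
    `|emb30 (J eta x) - emb E 0 x| <= c * eta * `|x| ;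
  smooth_id02 : forall eta, 0 < eta < 1 -> forall x : E 2%N,
    `|emb30 (J eta (emb E 1 x)) - emb20 x| <= c * eta ^+ 2 * `|x| ;
  smooth_id12 : forall eta, 0 < eta < 1 -> forall x : E 2%N,
    `|emb31 (J eta (emb E 1 x)) - emb E 1 x| <= c * eta * `|x| ;
  smooth11 : forall eta, 0 < eta < 1 -> forall x : E 1%N,
    `|emb31 (J eta x)| <= c * `|x| ;
  smooth12 : forall eta, 0 < eta < 1 -> forall x : E 1%N,
    `|emb E 2 (J eta x)| <= c * eta^-1 * `|x| ;
  smooth22 : forall eta, 0 < eta < 1 -> forall x : E 2%N,
    `|emb E 2 (J eta (emb E 1 x))| <= c * `|x| ;
  smooth13 : forall eta, 0 < eta < 1 -> forall x : E 1%N,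
    `|J eta x| <= c * eta ^- 2 * `|x| ;
  smooth23 : forall eta, 0 < eta < 1 -> forall x : E 2%N,
    `|J eta (emb E 1 x)| <= c * eta^-1 * `|x|
}.

(* [A1 n s t] and [A2 n s t] act on E_{-n} = dual (E n), and [A1s], [A2s] are
   the operators on test functions written A^{1,*}, A^{2,*}.  Only n = 0, 2 is
   used for A1, A1s and n = 0, 1 for A2, A2s. *)
Record driver E := Driver {
  A1 : forall n, R -> R -> {bounded dual (E n) -> dual (E n.+1)} ;
  A2 : forall n, R -> R -> {bounded dual (E n) -> dual (E n.+2)} ;
  A1s : forall n, R -> R -> {bounded E n.+1 -> E n} ;
  A2s : forall n, R -> R -> {bounded E n.+2 -> E n}
}.

Record rough_driver (p a b : R) E (A : driver E) (w : R -> R -> R) : Prop := {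
  driver_control : regular_control a b w ;
  driver_bound1 : forall n, n \in [:: 0; 2]%N ->
    forall s t, s \in `[a, b] -> t \in `[a, b] -> s <= t ->
      `|A1 A n s t| `^ p <= w s t ;
  driver_bound2 : forall n, n \in [:: 0; 1]%N ->
    forall s t, s \in `[a, b] -> t \in `[a, b] -> s <= t ->
      `|A2 A n s t| `^ (p / 2) <= w s t ;
  driver_adjoint1 : forall n, n \in [:: 0; 2]%N ->
    forall s t, s \in `[a, b] -> t \in `[a, b] -> s <= t ->
      forall (g : dual (E n)) (phi : E n.+1),
        A1 A n s t g phi = g (A1s A n s t phi) ;
  driver_adjoint2 : forall n, n \in [:: 0; 1]%N ->
    forall s t, s \in `[a, b] -> t \in `[a, b] -> s <= t ->
      forall (g : dual (E n)) (phi : E n.+2),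
        A2 A n s t g phi = g (A2s A n s t phi) ;
  driver_compat1 : forall s t, s \in `[a, b] -> t \in `[a, b] -> s <= t ->
    forall phi : E 3%N,
      emb20 (A1s A 2 s t phi) = A1s A 0 s t (emb31 phi) ;
  driver_compat2 : forall s t, s \in `[a, b] -> t \in `[a, b] -> s <= t ->
    forall phi : E 3%N,
      emb E 0 (A2s A 1 s t phi) = A2s A 0 s t (emb E 2 phi) ;
  driver_chen1 : forall n, n \in [:: 0; 2]%N ->
    forall s u t, s \in `[a, b] -> t \in `[a, b] -> s < u -> u < t ->
      delta2 (A1 A n) s u t = 0 ;
  driver_chen2 :
    forall s u t, s \in `[a, b] -> t \in `[a, b] -> s < u -> u < t ->
      forall phi : E 3%N,
        delta2 (A2s A 0) s u t (emb E 2 phi) =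
          A1s A 0 s u (emb E 1 (A1s A 2 u t phi))
}.

(* g solves dg = mu(dt) + A(dt) g with remainder gn.  On phi : E 3 the two
   versions of A1s (n = 0, 2), and of A2s, agree in E 0 by driver_compat1/2. *)
Definition solution (a b : R) E (A : driver E) (mu : R -> dual (E 3%N))
    (g : R -> dual (E 0%N)) (gn : R -> R -> dual (E 3%N)) : Prop :=
  forall s t, s \in `[a, b] -> t \in `[a, b] -> s < t -> forall phi : E 3%N,
    delta1 g s t (emb30 phi) =
      delta1 mu s t phi +
      g s (A1s A 0 s t (emb31 phi) + A2s A 0 s t (emb E 2 phi)) +
      gn s t phi.

(* The two inequalities are the cases k = 1 and k = 2. *)
Definition drift_bound (a b lambda : R) E (J : R -> {bounded E 1%N -> E 3%N})
    (mu : R -> dual (E 3%N)) (w1 w2 : R -> R -> R) : Prop :=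
  forall (phi : E 3%N) (s t eta : R),
    s \in `[a, b] -> t \in `[a, b] -> s < t -> 0 < eta < 1 ->
    `|delta1 mu s t (J eta (emb31 phi))| <=
      w1 s t * `|emb31 phi| + eta `^ (1 - lambda) * w2 s t * `|emb31 phi| /\
    `|delta1 mu s t (J eta (emb31 phi))| <=
      w1 s t * `|emb31 phi| + eta `^ (2 - lambda) * w2 s t * `|emb E 2 phi|.

Definition omega_star (p q kappa lambda : R) E (g : R -> dual (E 0%N))
    (wA w1 w2 : R -> R -> R) (s t : R) : \bar R :=
  (poweR (Linfty g s t) (q / 3)
     * (wA s t `^ (q / 3 * (3 / p - 2 * kappa)))%:E
   + (w1 s t `^ (q / 3) * wA s t `^ (q / (3 * p)))%:E
   + (w2 s t `^ (q / 3)
        * wA s t `^ (q / 3 * ((3 - lambda) / p + kappa * (lambda - 2))))%:E)%E.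

End Scale.

(* Main.v *)
Require Import Defs.
From mathcomp Require Import all_boot all_order all_algebra.
From mathcomp Require Import all_classical all_reals all_analysis.
From mathcomp Require Import ring lra.

Set Implicit Arguments.
Unset Strict Implicit.
Unset Printing Implicit Defensive.

Import Order.TTheory GRing.Theory Num.Theory.
Import numFieldNormedType.Exports.

Local Open Scope classical_set_scope.
Local Open Scope ring_scope.

(** The estimate is a fixed point argument for the size of the remainder [gn],
    run through the sewing lemma.

    Chen's relation expresses the defect [delta2 gn s u t] by the increment
    [delta1 g s u], applied to the image of the test function under
    [A2s u t], and by the first order remainder [delta1 g s u - A1 s u (g s)],
    applied to its image under [A1s u t] (lemma [delta_remainder]). Each of
    these two functionals is bounded after a smoothing at scale [eta]. On the
    smoothed test function the equation is inserted, which brings in the drift,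
    the driver, and the remainder [gn s u] itself, with negative powers of
    [eta]; on the difference the functionals are bounded by the norm of [g],
    with positive powers of [eta] ([increment_bound],
    [first_remainder_bound]). The bounds on the driver are assumed on the dual
    spaces, so they are applied to functionals only; no norm of an operator on
    test functions is needed.

    The scale [eta = Lam * wA s t `^ (p^-1 - kappa)] gives
    ([delta_remainder_bound])
      [`|delta2 gn s u t| <= K * Lam ^+ 2 * omega_star s t `^ (3 / q)
                              + K / Lam * w s t `^ (3 / q)]
    for every control [w] with [`|gn s t| <= w s t `^ (3 / q)]. The conditions
    on the parameters make [omega_star] a control, with the norm of [g] on the
    whole interval in the place of the local one, as a product of powers of
    controls is superadditive once the exponents add up to at least one
    ([powRM_superadditive]). Since [3 / q > 1], the sewing lemma turns the
    bound on the defect into a bound on [gn], and for [Lam] large the new bound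
    contains at most half of [w]. Iterating, the initial control of [gn]
    disappears in the limit ([sewing_absorb]). The constant [Lam] depends on
    [q] and on the constants of the scale and of the smoothing only, and
    [wA a b] has to be small for [eta] to be less than one. *)

(** * Superadditive power functions *)

Lemma le_powR {R : realType} (r x y : R) :
  0 <= r -> 0 <= x -> x <= y -> x `^ r <= y `^ r.
Proof.
by move=> r0 x0 xy; apply: ge0_ler_powR => //; rewrite nnegrE // (le_trans x0).
Qed.

Lemma powR_superadditive {R : realType} (r x y : R) :
  1 <= r -> 0 <= x -> 0 <= y -> x `^ r + y `^ r <= (x + y) `^ r.
Proof.
move=> r1 x0 y0; have r0 : 0 < r by exact: lt_le_trans r1.
rewrite -(mulr_powRB1 x0 r0) -(mulr_powRB1 y0 r0).
rewrite -(mulr_powRB1 (addr_ge0 x0 y0) r0) mulrDl.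
by apply: lerD; apply: ler_wpM2l => //; apply: le_powR;
  rewrite ?subr_ge0//; lra.
Qed.

(** For [al + be = 1] this is Hoelder's inequality; the general case follows
    by raising it to the power [al + be >= 1]. *)
Lemma powRM_superadditive {R : realType} (al be x1 x2 y1 y2 : R) :
  0 < al -> 0 < be -> 1 <= al + be ->
  0 <= x1 -> 0 <= x2 -> 0 <= y1 -> 0 <= y2 ->
  x1 `^ al * y1 `^ be + x2 `^ al * y2 `^ be <=
    (x1 + x2) `^ al * (y1 + y2) `^ be.
Proof.
move=> al0 be0 ab1 x10 x20 y10 y20; set r := al + be in ab1 *.
have r0 : 0 < r by exact: lt_le_trans ab1.
have rN0 : r != 0 by rewrite gt_eqF.
have split_pow (x y : R) : x `^ al * y `^ be =
    (x `^ (al / r) * y `^ (be / r)) `^ r.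
  by rewrite powRM ?powR_ge0// -!powRrM !divfK.
have hold := @hoelder2 R (x1 `^ (al / r)) (x2 `^ (al / r))
  (y1 `^ (be / r)) (y2 `^ (be / r)) (r / al) (r / be)
  (powR_ge0 _ _) (powR_ge0 _ _) (powR_ge0 _ _) (powR_ge0 _ _)
  (divr_gt0 r0 al0) (divr_gt0 r0 be0).
have cancel_al : al / r * (r / al) = 1 by field; rewrite rN0 gt_eqF.
have cancel_be : be / r * (r / be) = 1 by field; rewrite rN0 gt_eqF.
have inv_sum : (r / al)^-1 + (r / be)^-1 = 1.
  by rewrite !invf_div -mulrDl divff.
move: (hold inv_sum); rewrite -!powRrM cancel_al cancel_be.
rewrite !powRr1// !invf_div => {}hold.
rewrite !split_pow; apply: le_trans (powR_superadditive ab1 _ _) _;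
  rewrite ?mulr_ge0 ?powR_ge0//.
by apply: le_powR hold; rewrite ?(ltW r0)// addr_ge0// mulr_ge0 ?powR_ge0.
Qed.

(** * Controls *)

Section Controls.
Context {R : realType} {a b : R}.
Implicit Types w : R -> R -> R.

Lemma control_ge0 w s t : control a b w ->
  s \in `[a, b] -> t \in `[a, b] -> s <= t -> 0 <= w s t.
Proof. by case=> w0 _; exact: w0. Qed.

Lemma control_diag w s : control a b w -> s \in `[a, b] -> w s s = 0.
Proof.
move=> [w0 wD] sI; apply/eqP; rewrite eq_le w0// andbT.
by rewrite -(lerD2l (w s s)) addr0 wD.
Qed.

Lemma control_le w s s' t' t : control a b w ->
  s \in `[a, b] -> t \in `[a, b] -> s <= s' -> s' <= t' -> t' <= t ->
  w s' t' <= w s t.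
Proof.
move=> [w0 wD] sI tI ss' s't' t't.
have s'I : s' \in `[a, b] by move: sI tI; rewrite !in_itv/=; lra.
have t'I : t' \in `[a, b] by move: sI tI; rewrite !in_itv/=; lra.
have := wD s s' t sI tI ss' (le_trans s't' t't).
have := wD s' t' t s'I tI s't' t't.
by have := w0 s s' sI s'I ss'; have := w0 t' t t'I tI t't; lra.
Qed.

Lemma control_sub w a' b' : a <= a' -> b' <= b ->
  control a b w -> control a' b' w.
Proof.
move=> aa' bb' [w0 wD].
have sub x : x \in `[a', b'] -> x \in `[a, b] by rewrite !in_itv/=; lra.
by split=> [s t sI tI|s u t sI tI]; [apply: w0|apply: wD]; exact: sub.
Qed.

Lemma regular_control_sub w a' b' : a <= a' -> b' <= b ->
  regular_control a b w -> regular_control a' b' w.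
Proof.
move=> aa' bb' [cw rw]; split; first exact: control_sub cw.
have sub x : x \in `[a', b'] -> x \in `[a, b] by rewrite !in_itv/=; lra.
move=> e /rw[d d0 wd]; exists d => // s t sI tI; apply: wd; exact: sub.
Qed.

Lemma controlD w1 w2 : control a b w1 -> control a b w2 ->
  control a b (fun s t => w1 s t + w2 s t).
Proof.
move=> [w10 w1D] [w20 w2D]; split=> [s t sI tI st|s u t sI tI su ut].
  by rewrite addr_ge0 ?w10 ?w20.
by rewrite addrACA lerD ?w1D ?w2D.
Qed.

Lemma controlZ c w : 0 <= c -> control a b w ->
  control a b (fun s t => c * w s t).
Proof.
move=> c0 [w0 wD]; split=> [s t sI tI st|s u t sI tI su ut].
  by rewrite mulr_ge0 ?w0.
by rewrite -mulrDr ler_wpM2l// wD.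
Qed.

Let in_between s u t : s \in `[a, b] -> t \in `[a, b] -> s <= u -> u <= t ->
  u \in `[a, b].
Proof. by rewrite !in_itv/=; lra. Qed.

Lemma control_powR w r : 1 <= r -> control a b w ->
  control a b (fun s t => w s t `^ r).
Proof.
move=> r1 [w0 wD]; split=> [s t _ _ _|s u t sI tI su ut].
  exact: powR_ge0.
have uI := in_between sI tI su ut.
apply: le_trans (powR_superadditive r1 _ _) _; rewrite ?w0//.
by apply: le_powR; rewrite ?wD ?addr_ge0 ?w0//; lra.
Qed.

Lemma control_powRM w1 w2 al be : 0 < al -> 0 < be -> 1 <= al + be ->
  control a b w1 -> control a b w2 ->
  control a b (fun s t => w1 s t `^ al * w2 s t `^ be).
Proof.
move=> al0 be0 ab1 [w10 w1D] [w20 w2D].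
split=> [s t _ _ _|s u t sI tI su ut]; first by rewrite mulr_ge0 ?powR_ge0.
have uI := in_between sI tI su ut.
apply: le_trans (powRM_superadditive al0 be0 ab1 _ _ _ _) _;
  rewrite ?w10 ?w20//.
apply: ler_pM; rewrite ?powR_ge0//; apply: le_powR;
  rewrite ?(ltW al0) ?(ltW be0)// ?addr_ge0 ?w10 ?w20 ?w1D ?w2D//.
Qed.

End Controls.

(** * The sewing lemma *)

(** The constant of the sewing lemma of exponent [th]: the solution of
    [C = 2 + 2 * 2 `^ (- th) * C]. *)
Definition sewing_const {R : realType} (th : R) : R := 2 / (1 - 2 `^ (1 - th)).

Lemma powR2_lt1 {R : realType} (th : R) : 1 < th -> (2 : R) `^ (1 - th) < 1.
Proof.
move=> th1; rewrite /powR pnatr_eq0/= -[ltRHS]expR0 ltr_expR.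
by rewrite nmulr_rlt0 ?subr_lt0// ln_gt0// ltr1n.
Qed.

Lemma sewing_const_gt0 {R : realType} (th : R) : 1 < th -> 0 < sewing_const th.
Proof. by move=> th1; rewrite divr_gt0// subr_gt0 powR2_lt1. Qed.

Lemma sewing_const_fix {R : realType} (th : R) : 1 < th ->
  2 + 2 * (2^-1 `^ th * sewing_const th) = sewing_const th.
Proof.
move=> th1; have := powR2_lt1 th1; rewrite /sewing_const.
have -> : (2 : R) `^ (1 - th) = 2 * 2^-1 `^ th.
  rewrite powRD ?pnatr_eq0 ?implybT// powRr1// -[2^-1 in RHS]powR_inv1//.
  by rewrite -powRrM mulN1r.
by move=> lt1; field; rewrite gt_eqF// subr_gt0.
Qed.

Section Sewing.
Context {R : realType} {W : normedModType R} {a b th : R}.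
Variables (h : R -> R -> W) (w : R -> R -> R).
Hypothesis th1 : 1 < th.
Hypothesis cw : control a b w.
Hypothesis h_diag : forall s, s \in `[a, b] -> h s s = 0.
Hypothesis delta_h : forall s u t, s \in `[a, b] -> t \in `[a, b] ->
  s < u -> u < t -> `|delta2 h s u t| <= w s t `^ th.

Let partition_split (x y z u v S1 S2 : W) : x - (S1 + (u + S2)) =
  (x - y - z) + (z - u - v) + (y - S1) + (v - S2).
Proof.
rewrite -[z - u - v]addrA subrKA.
have -> : x - y + (- u - v) = x - u - v - y by rewrite addrACA addrA addrAC.
rewrite subrKA.
have -> : x - u - v - S1 = x - u - S1 - v by rewrite addrAC.
by rewrite subrKA !opprD !addrA [x - u - S1]addrAC.
Qed.

Let delta_h_le s u t : s \in `[a, b] -> t \in `[a, b] ->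
  s <= u -> u <= t -> `|delta2 h s u t| <= w s t `^ th.
Proof.
move=> sI tI; rewrite le_eqVlt => /predU1P[<- _|su].
  by rewrite /delta2 h_diag// subr0 subrr normr0 powR_ge0.
rewrite le_eqVlt => /predU1P[->|ut]; last exact: delta_h.
by rewrite /delta2 h_diag// subr0 subrr normr0 powR_ge0.
Qed.

(** Every partition has a mesh interval, from [x k] to [x k.+1], with both
    [w (x i) (x k)] and [w (x k.+1) (x j)] at most half of [w (x i) (x j)].
    Inserting its two ends costs [2 * w (x i) (x j) `^ th], and on both sides
    the bound improves by the factor [2 `^ (- th) < 1 / 2], so that the costs
    are summable. *)
Lemma sewing_partition (x : nat -> R) :
  (forall n, x n \in `[a, b]) -> {homo x : i j / (i <= j)%N >-> i <= j} ->
  forall i j, (i <= j)%N ->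
  `|h (x i) (x j) - \sum_(i <= k < j) h (x k) (x k.+1)| <=
    sewing_const th * w (x i) (x j) `^ th.
Proof.
move=> xI x_le i j; have [n] := ubnP (j - i)%N.
elim: n i j => // n IHn i j; rewrite ltnS => ijn ij.
have C0 := ltW (sewing_const_gt0 th1).
have th0 : 0 <= th by apply: ltW; apply: lt_trans th1.
move: ij; rewrite leq_eqVlt => /predU1P[<-|ij].
  by rewrite big_geq// h_diag// subr0 normr0 mulr_ge0// powR_ge0.
set X := w (x i) (x j).
have X0 : 0 <= X by apply: (control_ge0 cw); rewrite ?x_le// ltnW.
have [k [ik kj wik wkj]] : exists k, [/\ (i <= k)%N, (k < j)%N,
    w (x i) (x k) <= 2^-1 * X & w (x k.+1) (x j) <= 2^-1 * X].
  pose P k := [&& (i <= k)%N, (k < j)%N & w (x i) (x k) <= 2^-1 * X].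
  have exP : exists k, P k.
    by exists i; rewrite /P leqnn ij (control_diag cw)// mulr_ge0// invr_ge0.
  have ubP k : P k -> (k <= j)%N by case/and3P=> _ /ltnW.
  case: (ex_maxnP exP ubP) => k /and3P[ik kj wik] kmax; exists k; split=> //.
  have [kj1|kj1] := eqVneq k.+1 j.
    by rewrite kj1 (control_diag cw)// mulr_ge0// invr_ge0.
  have k1j : (k.+1 < j)%N by rewrite ltn_neqAle kj1.
  have : ~~ P k.+1 by apply/negP => /kmax; rewrite ltnn.
  rewrite /P (leqW ik) k1j/= -ltNge => wik1.
  have := cw.2 (x i) (x k.+1) (x j) (xI _) (xI _) (x_le _ _ (leqW ik))
    (x_le _ _ (ltnW k1j)).
  by rewrite -/X; lra.
have ki : (k - i < n)%N by apply: leq_trans ijn; rewrite ltn_sub2r.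
have jk : (j - k.+1 < n)%N.
  by apply: leq_trans ijn; rewrite -subSn// subSS leq_sub2l.
have := IHn _ _ ki ik; have := IHn _ _ jk kj.
rewrite [in X in _ -> _ -> X](big_cat_nat _ (n := k))//= ?(ltnW kj)//.
rewrite [in X in _ -> _ -> X](big_ltn kj).
set S1 := \sum_(i <= k < _) _; set S2 := \sum_(k.+1 <= k < _) _.
have half z : 0 <= z -> z <= 2^-1 * X ->
    sewing_const th * z `^ th <= 2^-1 `^ th * sewing_const th * X `^ th.
  move=> z0 zX; rewrite [leRHS]mulrAC [leRHS]mulrC ler_wpM2l//.
  by rewrite -powRM ?invr_ge0//; exact: le_powR.
have wik0 : 0 <= w (x i) (x k) by apply: (control_ge0 cw); rewrite ?x_le.
have wkj0 : 0 <= w (x k.+1) (x j) by apply: (control_ge0 cw); rewrite ?x_le.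
move=> /le_trans/(_ (half _ wkj0 wkj)) H2 /le_trans/(_ (half _ wik0 wik)) H1.
have D1 := delta_h_le (xI i) (xI j) (x_le _ _ ik) (x_le _ _ (ltnW kj)).
have D2 := delta_h_le (xI k) (xI j) (x_le _ _ (leqnSn k)) (x_le _ _ kj).
have {}D2 : `|delta2 h (x k) (x k.+1) (x j)| <= X `^ th.
  apply: le_trans D2 _; apply: le_powR => //.
    by apply: (control_ge0 cw); rewrite ?x_le// ltnW.
  by apply: (control_le cw); rewrite ?x_le// ltnW.
have -> : h (x i) (x j) - (S1 + (h (x k) (x k.+1) + S2)) =
    delta2 h (x i) (x k) (x j) + delta2 h (x k) (x k.+1) (x j) +
    (h (x i) (x k) - S1) + (h (x k.+1) (x j) - S2).
  exact: partition_split.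
rewrite -[X in _ <= X * _](sewing_const_fix th1).
move: H1 H2 D1 D2; rewrite -/X.
set d1 := delta2 _ _ _ _; set d2 := delta2 _ _ _ _.
set d3 := _ - S1; set d4 := _ - S2; set Y := X `^ th.
set c := _ * sewing_const _.
have := ler_normD (d1 + d2 + d3) d4; have := ler_normD (d1 + d2) d3.
by have := ler_normD d1 d2; lra.
Qed.

Let control_sum (v : R -> R -> R) (x : nat -> R) n : control a b v ->
  (forall n, x n \in `[a, b]) -> {homo x : i j / (i <= j)%N >-> i <= j} ->
  \sum_(0 <= k < n) v (x k) (x k.+1) <= v (x 0) (x n).
Proof.
move=> cv xI x_le; elim: n => [|n IHn].
  by rewrite big_geq// (control_diag cv).
rewrite big_nat_recr//=; apply: le_trans (cv.2 (x 0) (x n) _ _ _ _ _);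
  by rewrite ?lerD2r ?x_le.
Qed.

(** The sewing lemma in its maximal inequality form. The control [w] need not
    be regular: regularity is used only for [wn], to make the Riemann sums of
    [h] vanish as the mesh goes to zero. *)
Lemma sewing (wn : R -> R -> R) : regular_control a b wn ->
  (forall s t, s \in `[a, b] -> t \in `[a, b] -> s <= t ->
    `|h s t| <= wn s t `^ th) ->
  forall s t, s \in `[a, b] -> t \in `[a, b] -> s <= t ->
    `|h s t| <= sewing_const th * w s t `^ th.
Proof.
move=> [cwn rwn] h_wn s t sI tI st; apply/ler_addgt0Pr => e e0.
set M := wn s t; have M0 : 0 <= M by exact: control_ge0 cwn _ _ _.
have M1 : 0 < 1 + M by lra.
have th0 : 0 < th - 1 by rewrite subr_gt0.
(* Intervals on which [wn] is below [e1] contribute at most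
   [e1 `^ (th - 1) * M <= e] to the sum of the [wn _ _ `^ th]. *)
pose e1 := (e / (1 + M)) `^ (th - 1)^-1.
have e10 : 0 < e1 by rewrite powR_gt0// divr_gt0.
have e1E : e1 `^ (th - 1) = e / (1 + M).
  by rewrite -powRrM mulVf ?gt_eqF// powRr1// ltW// divr_gt0.
have [d d0 wn_small] := rwn e1 e10.
have td0 : 0 <= (t - s) / d by rewrite divr_ge0 ?subr_ge0// ltW.
pose N := Num.bound ((t - s) / d).
have tdN : (t - s) / d < N%:R by exact: archi_boundP.
have N0 : (0 : R) < N%:R by exact: le_lt_trans tdN.
pose st_N := (t - s) / N%:R.
have st_N0 : 0 <= st_N by rewrite divr_ge0 ?subr_ge0// ltW.
have st_Nd : st_N < d by rewrite ltr_pdivrMr// mulrC -ltr_pdivrMr.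
(* The uniform partition of [s, t] in N intervals, constant from N on. *)
pose x k : R := s + (minn k N)%:R * st_N.
have x0 : x 0%N = s by rewrite /x min0n mul0r addr0.
have xN : x N = t by rewrite /x minnn mulrC divfK ?gt_eqF// addrC subrK.
have x_le : {homo x : i j / (i <= j)%N >-> i <= j}.
  move=> i j ij; rewrite lerD2l ler_wpM2r// ler_nat.
  by rewrite leq_min !geq_min ij leqnn orbT.
have xI n : x n \in `[a, b].
  have sx : s <= x n by rewrite -x0 x_le.
  have xt : x n <= t.
    by rewrite -xN /x minnn lerD2l ler_wpM2r// ler_nat geq_minr.
  by move: sI tI; rewrite !in_itv/=; lra.
have x_step k : x k.+1 - x k < d.
  apply: le_lt_trans st_Nd; rewrite /x opprD addrACA subrr add0r -mulrBl.
  rewrite -[leRHS]mul1r ler_wpM2r// lerBlDr nat1r ler_nat.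
  by rewrite -minnSS leq_min geq_minl/= geq_min leqnSn orbT.
have := sewing_partition xI x_le (leq0n N); rewrite x0 xN => sew.
rewrite -[h s t](subrK (\sum_(0 <= k < N) h (x k) (x k.+1))).
apply: le_trans (ler_normD _ _) _; apply: lerD => //.
apply: le_trans (ler_norm_sum _ _ _) _.
apply: (@le_trans _ _ (\sum_(0 <= k < N) e1 `^ (th - 1) * wn (x k) (x k.+1))).
  apply: ler_sum => k _; have xk := x_le _ _ (leqnSn k).
  have wn0 : 0 <= wn (x k) (x k.+1) by exact: control_ge0 cwn _ _ _.
  apply: le_trans (h_wn _ _ _ _ _) _ => //.
  rewrite -mulr_powRB1//; last by rewrite (lt_trans _ th1).
  rewrite mulrC ler_wpM2r//; apply: le_powR => //; first exact: ltW.
  by rewrite ltW// wn_small.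
rewrite -mulr_sumr e1E.
apply: (@le_trans _ _ (e / (1 + M) * M)).
  rewrite ler_wpM2l ?divr_ge0 ?(ltW e0) ?(ltW M1)//.
  by rewrite -[X in _ <= wn X _]x0 -xN control_sum.
by rewrite mulrAC ler_pdivrMr// ler_wpM2l//; lra.
Qed.

End Sewing.

(** If [delta2 h] is bounded by a fixed control [ws] plus a small multiple of
    any control [w] that bounds [h], then [ws] alone bounds [h]. Iterating the
    sewing lemma bounds [h s t] by [(A * ws s t + 2 ^- n * wn s t) `^ th] for
    every [n]. *)
Lemma sewing_absorb {R : realType} {W : normedModType R} (a b th K eps : R)
    (h : R -> R -> W) (ws wn : R -> R -> R) :
  1 < th -> 0 <= K -> 0 <= eps -> sewing_const th * eps <= 2^-1 `^ th ->
  control a b ws -> regular_control a b wn ->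
  (forall s t, s \in `[a, b] -> t \in `[a, b] -> s <= t ->
    `|h s t| <= wn s t `^ th) ->
  (forall w, control a b w ->
    (forall s t, s \in `[a, b] -> t \in `[a, b] -> s <= t ->
      `|h s t| <= w s t `^ th) ->
    forall s u t, s \in `[a, b] -> t \in `[a, b] -> s < u -> u < t ->
      `|delta2 h s u t| <= K * ws s t `^ th + eps * w s t `^ th) ->
  forall s t, s \in `[a, b] -> t \in `[a, b] -> s <= t ->
    `|h s t| <= 2 `^ th * (sewing_const th * K) * ws s t `^ th.
Proof.
move=> th1 K0 eps0 small cws rwn h_wn h_w s0 t0 s0I t0I st0.
have th0 : 0 < th by exact: lt_trans th1.
have thN0 : th != 0 by rewrite gt_eqF.
have C0 := ltW (sewing_const_gt0 th1).
have root x : 0 <= x -> (x `^ th^-1) `^ th = x.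
  by move=> x0; rewrite -powRrM mulVf// powRr1.
have root' x : 0 <= x -> (x `^ th) `^ th^-1 = x.
  by move=> x0; rewrite -powRrM mulfV// powRr1.
have h_diag s : s \in `[a, b] -> h s s = 0.
  move=> sI; apply/eqP; rewrite -normr_le0.
  apply: le_trans (h_wn _ _ _ _ _) _ => //.
  by rewrite (control_diag rwn.1)// powR0.
pose A := 2 * (sewing_const th `^ th^-1 * K `^ th^-1).
have A0 : 0 <= A by rewrite !mulr_ge0 ?powR_ge0.
have half0 n : (0 : R) <= 2^-1 ^+ n by rewrite exprn_ge0// invr_ge0.
have iter n s t : s \in `[a, b] -> t \in `[a, b] -> s <= t ->
    `|h s t| <= (A * ws s t + 2^-1 ^+ n * wn s t) `^ th.
  elim: n s t => [|n IHn] s t sI tI st.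
    apply: le_trans (h_wn _ _ sI tI st) _; rewrite expr0 mul1r.
    apply: le_powR; rewrite ?(ltW th0) ?(control_ge0 rwn.1)//.
    by rewrite lerDr mulr_ge0// (control_ge0 cws).
  have cw := controlD (controlZ A0 cws) (controlZ (half0 n) rwn.1).
  have cw' := controlD (controlZ (powR_ge0 K th^-1) cws)
    (controlZ (powR_ge0 eps th^-1) cw).
  have dh s' u' t' : s' \in `[a, b] -> t' \in `[a, b] -> s' < u' -> u' < t' ->
      `|delta2 h s' u' t'| <= (K `^ th^-1 * ws s' t' +
        eps `^ th^-1 * (A * ws s' t' + 2^-1 ^+ n * wn s' t')) `^ th.
    move=> s'I t'I su ut; have st' := ltW (lt_trans su ut).
    apply: le_trans (h_w _ cw IHn s' u' t' s'I t'I su ut) _.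
    have ws0 := control_ge0 cws s'I t'I st'.
    have w0 := control_ge0 cw s'I t'I st'.
    apply: le_trans (powR_superadditive (ltW th1) _ _);
      rewrite ?mulr_ge0 ?powR_ge0//.
    by rewrite !powRM ?powR_ge0// !root.
  apply: le_trans (sewing th1 cw' h_diag dh rwn h_wn sI tI st) _.
  have ws0 := control_ge0 cws sI tI st; have wn0 := control_ge0 rwn.1 sI tI st.
  have w0 := control_ge0 cw sI tI st; have w'0 := control_ge0 cw' sI tI st.
  rewrite -{1}(root (sewing_const th))// -powRM ?powR_ge0//.
  apply: le_powR; rewrite ?(ltW th0) ?mulr_ge0 ?powR_ge0//.
  rewrite mulrDr.
  have small_root : (sewing_const th * eps) `^ th^-1 <= 2^-1.
    rewrite -[leRHS]root' ?invr_ge0//.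
    apply: le_powR small; last exact: mulr_ge0.
    by rewrite invr_ge0 ltW.
  rewrite powRM// in small_root.
  have := ler_wpM2r w0 small_root; rewrite exprS /A.
  set B := sewing_const th `^ _; set D := K `^ _; set F := eps `^ _.
  by set H := 2^-1 ^+ n; lra.
have h_lim : `|h s0 t0| `^ th^-1 <= A * ws s0 t0.
  apply/ler_addgt0Pr => e e0; have wn0 := control_ge0 rwn.1 s0I t0I st0.
  pose n := Num.bound (wn s0 t0 / e).
  have : wn s0 t0 / e < n%:R by apply: archi_boundP; rewrite divr_ge0// ltW.
  have n2n : n%:R <= 2 ^+ n :> R by rewrite -natrX ler_nat ltnW// ltn_expl.
  move=> /lt_le_trans/(_ n2n); rewrite ltr_pdivrMr// => wn_e.
  have ws0 := control_ge0 cws s0I t0I st0.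
  have sum0 : 0 <= A * ws s0 t0 + 2^-1 ^+ n * wn s0 t0.
    by rewrite addr_ge0// mulr_ge0.
  rewrite (@le_trans _ _ (A * ws s0 t0 + 2^-1 ^+ n * wn s0 t0))//.
    rewrite -[leRHS]root'//; apply: le_powR; rewrite ?invr_ge0 ?(ltW th0)//.
    exact: iter.
  by rewrite lerD2l exprVn mulrC ler_pdivrMr ?exprn_gt0// mulrC ltW.
rewrite -[leLHS]root//.
apply: le_trans (le_powR (ltW th0) (powR_ge0 _ _) h_lim) _.
have ws0 := control_ge0 cws s0I t0I st0.
rewrite (powRM _ A0 ws0) ler_wpM2r ?powR_ge0//.
rewrite powRM ?mulr_ge0 ?powR_ge0// (powRM _ (powR_ge0 _ _) (powR_ge0 _ _)).
by rewrite !root.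
Qed.

(** * Bounded operators *)

Lemma ler_norm_bop {R : realType} {V W : normedModType R} (f : bop V W) x :
  `|f x| <= `|f| * `|x|.
Proof. exact: ler_opnorm. Qed.

Lemma bop_norm_le {R : realType} {V W : normedModType R} (f : bop V W) (c : R) :
  0 <= c -> (forall x, `|f x| <= c * `|x|) -> `|f| <= c.
Proof.
move=> c0 fc; rewrite -[`|f|]/(opnorm f); apply: ge_sup.
  by exists `|f 0|; exists 0 => //=; rewrite normr0.
by move=> _ [x /= x1 <-]; apply: le_trans (fc x) _; rewrite ler_piMr.
Qed.

Section Composition.
Context {R : realType} {U V W : normedModType R} (f : bop V W) (g : bop U V).

Lemma bop_comp_subproof : (f \o g : U -> W) \in bounded_op.
Proof.
apply/asboolP; split=> [k x y|x]; first by rewrite /= !linearP.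
by apply: continuous_comp; exact: bop_continuous.
Qed.

(** Composition of bounded operators. *)
Definition bop_comp : bop U W := Bop bop_comp_subproof.

End Composition.

Lemma dual_BE {R : realType} {V : normedModType R} (f g : dual V) x :
  (f - g) x = f x - g x.
Proof. by []. Qed.

(** * Smoothing twice *)

(** The drift is only estimated on [J eta phi] with [phi] in [E 3]. A test
    function in [E 1] or [E 2] is therefore smoothed twice: the first
    smoothing brings it into [E 3]. *)
Definition smooth_twice {R : realType} {E : scale R}
    (J : R -> {bounded E 1%N -> E 3%N}) (eta : R) (psi : E 1%N) : E 3%N :=
  J eta (emb31 (J eta psi)).

Section Smoothing.
Context {R : realType} {E : scale R} (J : R -> {bounded E 1%N -> E 3%N}).
Variables e c : R.
Hypothesis e1 : 1 <= e.
Hypothesis c1 : 1 <= c.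
Hypothesis Ebd : embedding_bound E e.
Hypothesis Jbd : smoothing_bound J c.
Variable eta : R.
Hypothesis eta01 : 0 < eta < 1.

Let B := c ^+ 2 * e.

Let c0 : 0 <= c. Proof. by move: c1; lra. Qed.
Let eta0 : 0 <= eta. Proof. by case/andP: eta01 => /ltW. Qed.
Let cc : c <= c ^+ 2. Proof. by rewrite expr2 ler_peMr. Qed.
Let c2B : c ^+ 2 <= B. Proof. by rewrite ler_peMr// exprn_ge0. Qed.
Let cB : c <= B. Proof. exact: le_trans c2B. Qed.
Let e0 : 0 <= e. Proof. by move: e1; lra. Qed.
Let ceB : c * e <= B. Proof. by rewrite ler_wpM2r. Qed.

Lemma smooth_twice_E2 (psi : E 2%N) :
  let x := J eta (emb E 1 psi) in let y := smooth_twice J eta (emb E 1 psi) in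
  [/\ `|emb31 x| <= B * `|psi|, `|emb E 2 x| <= B * `|psi|,
      `|emb E 2 y| <= B * `|psi| & `|y| <= B * eta^-1 * `|psi|] /\
  `|emb20 psi - emb30 y| <= 2 * B * eta ^+ 2 * `|psi| /\
  `|emb E 1 psi - emb31 y| <= 2 * B * eta * `|psi|.
Proof.
move=> x y; set r := `|psi|; have r0 : 0 <= r by exact: normr_ge0.
have x31 : `|emb31 x| <= c * e * r.
  apply: le_trans (smooth11 Jbd eta01 _) _; rewrite -mulrA ler_wpM2l//.
  exact: Ebd.
have x2 : `|emb E 2 x| <= c * r by exact: (smooth22 Jbd eta01).
have y2 : `|emb E 2 y| <= c ^+ 2 * r.
  apply: le_trans (smooth22 Jbd eta01 (emb E 2 x)) _.
  by rewrite expr2 -mulrA ler_wpM2l.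
have ye : `|y| <= c ^+ 2 * eta^-1 * r.
  apply: le_trans (smooth23 Jbd eta01 (emb E 2 x)) _.
  have -> : c ^+ 2 * eta^-1 * r = c * eta^-1 * (c * r) by ring.
  by rewrite ler_wpM2l// mulr_ge0 ?invr_ge0.
have y20 : `|emb20 psi - emb30 y| <= (c + c ^+ 2) * eta ^+ 2 * r.
  have -> : emb20 psi - emb30 y =
      (emb20 psi - emb30 x) + (emb20 (emb E 2 x) - emb30 y).
    by rewrite addrA subrK.
  apply: le_trans (ler_normD _ _) _; rewrite !mulrDl; apply: lerD.
    by rewrite distrC; exact: (smooth_id02 Jbd eta01).
  rewrite distrC; apply: le_trans (smooth_id02 Jbd eta01 (emb E 2 x)) _.
  have -> : c ^+ 2 * eta ^+ 2 * r = c * eta ^+ 2 * (c * r) by ring.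
  by rewrite ler_wpM2l// mulr_ge0 ?exprn_ge0.
have y1 : `|emb E 1 psi - emb31 y| <= (c + c ^+ 2) * eta * r.
  have -> : emb E 1 psi - emb31 y =
      (emb E 1 psi - emb31 x) + (emb E 1 (emb E 2 x) - emb31 y).
    by rewrite addrA subrK.
  apply: le_trans (ler_normD _ _) _; rewrite !mulrDl; apply: lerD.
    by rewrite distrC; exact: (smooth_id12 Jbd eta01).
  rewrite distrC; apply: le_trans (smooth_id12 Jbd eta01 (emb E 2 x)) _.
  have -> : c ^+ 2 * eta * r = c * eta * (c * r) by ring.
  by rewrite ler_wpM2l// mulr_ge0.
have cc2B : c + c ^+ 2 <= 2 * B by move: cB c2B; lra.
split; [split|split].
- by apply: le_trans x31 _; rewrite ler_wpM2r.
- by apply: le_trans x2 _; rewrite ler_wpM2r.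
- by apply: le_trans y2 _; rewrite ler_wpM2r.
- by apply: le_trans ye _; rewrite !ler_wpM2r ?invr_ge0.
- by apply: le_trans y20 _; rewrite !ler_wpM2r ?exprn_ge0.
- by apply: le_trans y1 _; rewrite !ler_wpM2r.
Qed.

Lemma smooth_twice_E1 (psi : E 1%N) :
  let x := J eta psi in let y := smooth_twice J eta psi in
  [/\ `|emb31 x| <= B * `|psi|, `|emb31 y| <= B * `|psi|,
      `|emb E 2 y| <= B * eta^-1 * `|psi| & `|y| <= B * eta ^- 2 * `|psi|] /\
  `|emb E 0 psi - emb30 y| <= 2 * B * eta * `|psi|.
Proof.
move=> x y; set r := `|psi|; have r0 : 0 <= r by exact: normr_ge0.
have x31 : `|emb31 x| <= c * r by exact: (smooth11 Jbd eta01).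
have y31 : `|emb31 y| <= c ^+ 2 * r.
  apply: le_trans (smooth11 Jbd eta01 (emb31 x)) _.
  by rewrite expr2 -mulrA ler_wpM2l.
have y2 : `|emb E 2 y| <= c ^+ 2 * eta^-1 * r.
  apply: le_trans (smooth12 Jbd eta01 (emb31 x)) _.
  have -> : c ^+ 2 * eta^-1 * r = c * eta^-1 * (c * r) by ring.
  by rewrite ler_wpM2l// mulr_ge0 ?invr_ge0.
have ye : `|y| <= c ^+ 2 * eta ^- 2 * r.
  apply: le_trans (smooth13 Jbd eta01 (emb31 x)) _.
  have -> : c ^+ 2 * eta ^- 2 * r = c * eta ^- 2 * (c * r) by ring.
  by rewrite ler_wpM2l// mulr_ge0 ?invr_ge0 ?exprn_ge0.
have y0 : `|emb E 0 psi - emb30 y| <= (c + c ^+ 2) * eta * r.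
  have -> : emb E 0 psi - emb30 y =
      (emb E 0 psi - emb30 x) + (emb E 0 (emb31 x) - emb30 y).
    by rewrite addrA subrK.
  apply: le_trans (ler_normD _ _) _; rewrite !mulrDl; apply: lerD.
    by rewrite distrC; exact: (smooth_id01 Jbd eta01).
  rewrite distrC; apply: le_trans (smooth_id01 Jbd eta01 (emb31 x)) _.
  have -> : c ^+ 2 * eta * r = c * eta * (c * r) by ring.
  by rewrite ler_wpM2l// mulr_ge0.
have cc2B : c + c ^+ 2 <= 2 * B by move: cB c2B; lra.
split; [split|].
- by apply: le_trans x31 _; rewrite ler_wpM2r.
- by apply: le_trans y31 _; rewrite ler_wpM2r.
- by apply: le_trans y2 _; rewrite !ler_wpM2r ?invr_ge0.
- by apply: le_trans ye _; rewrite !ler_wpM2r ?invr_ge0 ?exprn_ge0.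
- by apply: le_trans y0 _; rewrite !ler_wpM2r.
Qed.

End Smoothing.

Lemma embedding_bound_le {R : realType} (E : scale R) (c c' : R) :
  c <= c' -> embedding_bound E c -> embedding_bound E c'.
Proof.
by move=> cc' Ec n n3 x; apply: le_trans (Ec n n3 x) _; rewrite ler_wpM2r.
Qed.

Lemma smoothing_bound_le {R : realType} (E : scale R)
    (J : R -> {bounded E 1%N -> E 3%N}) (c c' : R) :
  c <= c' -> smoothing_bound J c -> smoothing_bound J c'.
Proof.
move=> cc' [b1 b2 b3 b4 b5 b6 b7 b8].
have eta_ge0 (eta : R) : 0 < eta < 1 -> 0 <= eta by case/andP => /ltW.
split=> eta eta01 x; have eta0 := eta_ge0 _ eta01.
- by apply: le_trans (b1 eta eta01 x) _; rewrite !ler_wpM2r.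
- by apply: le_trans (b2 eta eta01 x) _; rewrite !ler_wpM2r ?exprn_ge0.
- by apply: le_trans (b3 eta eta01 x) _; rewrite !ler_wpM2r.
- by apply: le_trans (b4 eta eta01 x) _; rewrite !ler_wpM2r.
- by apply: le_trans (b5 eta eta01 x) _; rewrite !ler_wpM2r ?invr_ge0.
- by apply: le_trans (b6 eta eta01 x) _; rewrite !ler_wpM2r.
- apply: le_trans (b7 eta eta01 x) _.
  by rewrite !ler_wpM2r ?invr_ge0 ?exprn_ge0.
- by apply: le_trans (b8 eta eta01 x) _; rewrite !ler_wpM2r ?invr_ge0.
Qed.

(** * The increments of the remainder *)

Section Remainder.
Context {R : realType} {p a b lambda : R} {E : scale R}.
Context {J : R -> {bounded E 1%N -> E 3%N}} {A : driver E}.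
Context {wA w1 w2 : R -> R -> R} {mu : R -> dual (E 3%N)}.
Context {g : R -> dual (E 0%N)} {gn : R -> R -> dual (E 3%N)}.
Hypothesis HA : rough_driver p a b A wA.
Hypothesis Hg : solution a b A mu g gn.

(** The two functionals through which [delta2 gn s u t] is expressed: the
    increment of [g], on [E 1], and its first order remainder
    [delta1 g s u - A1 s u (g s)], on [E 2]. *)
Definition increment (s u : R) : dual (E 1%N) :=
  bop_comp (delta1 g s u) (emb E 0).

Definition first_remainder (s u : R) : dual (E 2%N) :=
  (bop_comp (increment s u) (emb E 1) : dual (E 2%N))
  - (bop_comp (A1 A 0 s u (g s)) (emb E 1) : dual (E 2%N)).

Lemma incrementE s u psi :
  increment s u psi = g u (emb E 0 psi) - g s (emb E 0 psi).
Proof. by []. Qed.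

Lemma first_remainderE s u psi : first_remainder s u psi =
  g u (emb20 psi) - g s (emb20 psi) - A1 A 0 s u (g s) (emb E 1 psi).
Proof. by []. Qed.

Lemma delta_remainder s u t phi : s \in `[a, b] -> t \in `[a, b] ->
  s < u -> u < t ->
  delta2 gn s u t phi =
    A2 A 1 u t (increment s u) phi + A1 A 2 u t (first_remainder s u) phi.
Proof.
move=> sI tI su ut; have st := lt_trans su ut.
have uI : u \in `[a, b] by move: sI tI; rewrite !in_itv/=; lra.
have gnE s' t' : s' \in `[a, b] -> t' \in `[a, b] -> s' < t' ->
    gn s' t' phi = (g t' (emb30 phi) - g s' (emb30 phi)) -
      (mu t' phi - mu s' phi) - (g s' (A1s A 0 s' t' (emb31 phi)) +
        g s' (A2s A 0 s' t' (emb E 2 phi))).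
  move=> s'I t'I s't'; have := Hg s'I t'I s't' phi.
  rewrite /delta1 !dual_BE linearD => ->.
  ring.
rewrite (driver_adjoint2 HA) ?inE ?eqxx ?orbT ?(ltW ut)//.
rewrite (driver_adjoint1 HA) ?inE ?eqxx ?orbT ?(ltW ut)//.
rewrite incrementE first_remainderE.
rewrite (driver_compat1 HA uI tI (ltW ut)) (driver_compat2 HA uI tI (ltW ut)).
rewrite (driver_adjoint1 HA) ?inE ?eqxx ?(ltW su)//.
rewrite -(driver_chen2 HA sI tI su ut) /delta2 !linearB/=.
have chen1 : A1 A 0 s t = A1 A 0 s u + A1 A 0 u t.
  apply/eqP; rewrite -subr_eq0 opprD addrA; apply/eqP.
  exact: (driver_chen1 HA).
have {}chen1 : g s (A1s A 0 s t (emb31 phi)) =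
    g s (A1s A 0 s u (emb31 phi)) + g s (A1s A 0 u t (emb31 phi)).
  rewrite -!(driver_adjoint1 HA) ?inE ?eqxx ?(ltW su) ?(ltW ut) ?(ltW st)//.
  by rewrite chen1 bopDE bopDE.
rewrite -[LHS]/(gn s t phi - gn s u phi - gn u t phi) !gnE//.
by rewrite chen1; ring.
Qed.

Section Bounds.
Variables c e : R.
Hypothesis c1 : 1 <= c.
Hypothesis e1 : 1 <= e.
Hypothesis Ebd : embedding_bound E e.
Hypothesis Jbd : smoothing_bound J c.
Hypothesis Hmu : drift_bound a b lambda J mu w1 w2.
Variables (s u eta al G N v1 v2 : R).
Hypothesis sI : s \in `[a, b].
Hypothesis uI : u \in `[a, b].
Hypothesis su : s < u.
Hypothesis eta01 : 0 < eta < 1.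
Hypothesis al0 : 0 <= al.
Hypothesis A1_al : `|A1 A 0 s u| <= al.
Hypothesis A2_al : `|A2 A 0 s u| <= al ^+ 2.
Hypothesis gs_G : `|g s| <= G.
Hypothesis gu_G : `|g u| <= G.
Hypothesis gn_N : `|gn s u| <= N.
Hypothesis w1_v1 : w1 s u <= v1.
Hypothesis w2_v2 : w2 s u <= v2.
Hypothesis v10 : 0 <= v1.
Hypothesis v20 : 0 <= v2.

Let B := c ^+ 2 * e.
Let B0 : 0 <= B.
Proof. by move: c1 e1 => ? ?; rewrite mulr_ge0 ?exprn_ge0//; lra. Qed.
Let eta0 : 0 < eta. Proof. by case/andP: eta01. Qed.
Let G0 : 0 <= G. Proof. exact: le_trans gs_G. Qed.
Let N0 : 0 <= N. Proof. exact: le_trans gn_N. Qed.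

Let bop_le {V W : normedModType R} (f : bop V W) x (m n : R) :
  `|f| <= m -> `|x| <= n -> `|f x| <= m * n.
Proof.
by move=> fm xn; apply: le_trans (ler_norm_bop f x) _; apply: ler_pM.
Qed.

Let A1s_bound (x : E 1%N) n : `|x| <= n -> `|g s (A1s A 0 s u x)| <= al * G * n.
Proof.
move=> xn; rewrite -(driver_adjoint1 HA) ?inE ?eqxx ?(ltW su)//.
by apply: bop_le => //; exact: bop_le.
Qed.

Let A2s_bound (x : E 2%N) n :
  `|x| <= n -> `|g s (A2s A 0 s u x)| <= al ^+ 2 * G * n.
Proof.
move=> xn; rewrite -(driver_adjoint2 HA) ?inE ?eqxx ?(ltW su)//.
by apply: bop_le => //; exact: bop_le.
Qed.

Let delta_g_bound (x : E 0%N) n : `|x| <= n ->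
  `|g u x - g s x| <= 2 * G * n.
Proof.
move=> xn; apply: le_trans (ler_normB _ _) _.
by have := bop_le gs_G xn; have := bop_le gu_G xn; lra.
Qed.

Let gE (y : E 3%N) : g u (emb30 y) - g s (emb30 y) =
  (mu u y - mu s y) + g s (A1s A 0 s u (emb31 y)) +
  g s (A2s A 0 s u (emb E 2 y)) + gn s u y.
Proof.
rewrite -[LHS]/(delta1 g s u (emb30 y)) (Hg sI uI su y) linearD.
by rewrite -[delta1 mu s u y]/(mu u y - mu s y) !addrA.
Qed.

Lemma first_remainder_bound : `|first_remainder s u| <=
  4 * B * (v1 + eta `^ (2 - lambda) * v2
    + G * (al ^+ 2 + eta ^+ 2 + al * eta) + N * eta^-1).
Proof.
set P := eta `^ _; have P0 : 0 <= P by exact: powR_ge0.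
apply: bop_norm_le.
  have ieta : 0 <= eta^-1 by rewrite invr_ge0 ltW.
  have eta0' := ltW eta0.
  by repeat (exact: B0 || apply: addr_ge0 || apply: exprn_ge0
    || apply: mulr_ge0).
move=> psi; have := smooth_twice_E2 e1 c1 Ebd Jbd eta01 psi.
rewrite -/B; set x := J _ _; set y := smooth_twice _ _ _; set r := `|psi|.
move=> [[x31 x2 y2 yr] [y20 y1]]; have r0 : 0 <= r by exact: normr_ge0.
have -> : first_remainder s u psi =
    (g u (emb20 psi - emb30 y) - g s (emb20 psi - emb30 y))
    - g s (A1s A 0 s u (emb E 1 psi - emb31 y))
    + ((mu u y - mu s y) + g s (A2s A 0 s u (emb E 2 y)) + gn s u y).
  rewrite first_remainderE (driver_adjoint1 HA) ?inE ?eqxx ?(ltW su)//.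
  have -> : gn s u y = (g u (emb30 y) - g s (emb30 y)) - (mu u y - mu s y)
      - g s (A1s A 0 s u (emb31 y)) - g s (A2s A 0 s u (emb E 2 y)).
    by rewrite gE; ring.
  by rewrite !linearB/=; ring.
have mu_y : `|mu u y - mu s y| <= v1 * (B * r) + P * v2 * (B * r).
  have [_] := Hmu x sI uI su eta01; rewrite -/P => /le_trans; apply.
  apply: lerD; first exact: le_trans (ler_wpM2r _ w1_v1) (ler_wpM2l _ x31).
  apply: le_trans (ler_wpM2r _ (ler_wpM2l P0 w2_v2)) (ler_wpM2l _ x2) => //.
  exact: mulr_ge0.
have d1 := delta_g_bound y20; have d2 := A1s_bound y1.
have d3 := A2s_bound y2; have d4 := bop_le gn_N yr.
apply: le_trans (ler_normD _ _) _.
apply: le_trans (lerD (ler_normB _ _) (ler_normD _ _)) _.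
apply: le_trans (lerD (lexx _) (lerD (ler_normD _ _) (lexx _))) _.
apply: le_trans (lerD (lerD d1 d2) (lerD (lerD mu_y d3) d4)) _.
have Br : 0 <= B * r by exact: mulr_ge0.
have m1 := mulr_ge0 v10 Br; have m2 := mulr_ge0 (mulr_ge0 P0 v20) Br.
have m3 := mulr_ge0 (mulr_ge0 (exprn_ge0 2 al0) G0) Br.
have m4 := mulr_ge0 (mulr_ge0 N0 (ltW eta0)) Br.
have ieta : 0 <= eta^-1 by rewrite invr_ge0 ltW.
have m5 := mulr_ge0 (mulr_ge0 N0 ieta) Br.
have m6 := mulr_ge0 (mulr_ge0 (mulr_ge0 al0 G0) (ltW eta0)) Br.
lra.
Qed.

Lemma increment_bound : `|increment s u| <=
  4 * B * (v1 + eta `^ (1 - lambda) * v2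
    + G * (eta + al + al ^+ 2 * eta^-1) + N * eta ^- 2).
Proof.
set P := eta `^ _; have P0 : 0 <= P by exact: powR_ge0.
have ieta : 0 <= eta^-1 by rewrite invr_ge0 ltW.
have ieta2 : 0 <= eta ^- 2 by rewrite invr_ge0 exprn_ge0// ltW.
apply: bop_norm_le.
  have eta0' := ltW eta0.
  by repeat (exact: B0 || apply: addr_ge0 || apply: exprn_ge0
    || apply: mulr_ge0).
move=> psi; have := smooth_twice_E1 e1 c1 Jbd eta01 psi.
rewrite -/B; set x := J _ _; set y := smooth_twice _ _ _; set r := `|psi|.
move=> [[x31 y31 y2 yr] y0]; have r0 : 0 <= r by exact: normr_ge0.
have -> : increment s u psi =
    (g u (emb E 0 psi - emb30 y) - g s (emb E 0 psi - emb30 y))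
    + ((mu u y - mu s y) + g s (A1s A 0 s u (emb31 y))
       + g s (A2s A 0 s u (emb E 2 y)) + gn s u y).
  by rewrite incrementE -gE !linearB/=; ring.
have mu_y : `|mu u y - mu s y| <= v1 * (B * r) + P * v2 * (B * r).
  have [+ _] := Hmu x sI uI su eta01; rewrite -/P => /le_trans; apply.
  apply: lerD; first exact: le_trans (ler_wpM2r _ w1_v1) (ler_wpM2l _ x31).
  apply: le_trans (ler_wpM2r _ (ler_wpM2l P0 w2_v2)) (ler_wpM2l _ x31) => //.
  exact: mulr_ge0.
have d1 := delta_g_bound y0; have d2 := A1s_bound y31.
have d3 := A2s_bound y2; have d4 := bop_le gn_N yr.
apply: le_trans (ler_normD _ _) _.
apply: le_trans (lerD d1 (ler_normD _ _)) _.
apply: le_trans (lerD (lexx _) (lerD (ler_normD _ _) d4)) _.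
apply: le_trans (lerD (lexx _) (lerD (lerD (ler_normD _ _) d3) (lexx _))) _.
apply: le_trans
  (lerD (lexx _) (lerD (lerD (lerD mu_y d2) (lexx _)) (lexx _))) _.
have Br : 0 <= B * r by exact: mulr_ge0.
have m1 := mulr_ge0 v10 Br; have m2 := mulr_ge0 (mulr_ge0 P0 v20) Br.
have m3 := mulr_ge0 (mulr_ge0 al0 G0) Br.
have m4 := mulr_ge0 (mulr_ge0 N0 ieta2) Br.
have m5 := mulr_ge0 (mulr_ge0 (mulr_ge0 (exprn_ge0 2 al0) G0) ieta) Br.
have m6 := mulr_ge0 (mulr_ge0 G0 (ltW eta0)) Br.
lra.
Qed.

End Bounds.

End Remainder.

Arguments increment {R E} g s u.
Arguments first_remainder {R E} A g s u.

Section DeltaRemainder.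
Context {R : realType} {p a b lambda : R} {E : scale R}.
Context {J : R -> {bounded E 1%N -> E 3%N}} {A : driver E}.
Context {wA w1 w2 : R -> R -> R} {mu : R -> dual (E 3%N)}.
Context {g : R -> dual (E 0%N)} {gn : R -> R -> dual (E 3%N)}.
Hypothesis HA : rough_driver p a b A wA.
Hypothesis Hg : solution a b A mu g gn.
Hypothesis p0 : 0 < p.
Variables s u t : R.
Hypothesis sI : s \in `[a, b].
Hypothesis tI : t \in `[a, b].
Hypothesis su : s < u.
Hypothesis ut : u < t.

Let uI : u \in `[a, b].
Proof. by move: sI tI su ut; rewrite !in_itv/=; lra. Qed.

Let cA := (driver_control HA).1.

Lemma driver_norm1 n x y : n \in [:: 0; 2]%N -> s <= x -> x <= y -> y <= t ->
  `|A1 A n x y| <= wA s t `^ p^-1.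
Proof.
move=> n02 sx xy yt.
have xI : x \in `[a, b] by move: sI tI; rewrite !in_itv/=; lra.
have yI : y \in `[a, b] by move: sI tI; rewrite !in_itv/=; lra.
have bd := driver_bound1 HA n02 xI yI xy.
have {bd} := le_trans bd (control_le cA sI tI sx xy yt).
move/(le_powR (r := p^-1)) => H; rewrite -[leLHS](powRr1 (normr_ge0 _)).
by rewrite -(@mulfV _ p) ?gt_eqF// powRrM H ?powR_ge0// invr_ge0 ltW.
Qed.

Lemma driver_norm2 n x y : n \in [:: 0; 1]%N -> s <= x -> x <= y -> y <= t ->
  `|A2 A n x y| <= (wA s t `^ p^-1) ^+ 2.
Proof.
move=> n01 sx xy yt.
have xI : x \in `[a, b] by move: sI tI; rewrite !in_itv/=; lra.
have yI : y \in `[a, b] by move: sI tI; rewrite !in_itv/=; lra.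
have bd := driver_bound2 HA n01 xI yI xy.
have {bd} := le_trans bd (control_le cA sI tI sx xy yt).
move/(le_powR (r := p^-1 * 2)) => H.
rewrite -powR_mulrn ?powR_ge0// -[leRHS]powRrM.
have inv_p : p / 2 * (p^-1 * 2) = 1 by field; rewrite gt_eqF.
have -> : `|A2 A n x y| = (`|A2 A n x y| `^ (p / 2)) `^ (p^-1 * 2).
  by rewrite -powRrM inv_p powRr1.
by apply: H; rewrite ?powR_ge0// mulr_ge0// invr_ge0 ltW.
Qed.

Lemma delta_remainder_le m1 m2 :
  `|first_remainder A g s u| <= m1 -> `|increment g s u| <= m2 ->
  `|delta2 gn s u t| <=
    (wA s t `^ p^-1) ^+ 2 * m2 + wA s t `^ p^-1 * m1.
Proof.
move=> f1 f2; set al := wA s t `^ p^-1; have al0 : 0 <= al by exact: powR_ge0.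
have m10 := le_trans (normr_ge0 _) f1; have m20 := le_trans (normr_ge0 _) f2.
apply: bop_norm_le => [|phi].
  by rewrite addr_ge0// mulr_ge0// exprn_ge0.
rewrite (delta_remainder HA Hg phi sI tI su ut) mulrDl.
apply: le_trans (ler_normD _ _) _; apply: lerD.
  apply: le_trans (ler_norm_bop _ _) _; rewrite ler_wpM2r//.
  apply: le_trans (ler_norm_bop _ _) _.
  apply: ler_pM => //.
  exact: (driver_norm2 (n := 1) isT (ltW su) (ltW ut) (lexx _)).
apply: le_trans (ler_norm_bop _ _) _; rewrite ler_wpM2r//.
apply: le_trans (ler_norm_bop _ _) _.
apply: ler_pM => //.
exact: (driver_norm1 (n := 2) isT (ltW su) (ltW ut) (lexx _)).
Qed.

Lemma delta_remainder_eq0 : wA s t = 0 -> delta2 gn s u t = 0.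
Proof.
move=> W0; apply/eqP; rewrite -normr_le0.
have := delta_remainder_le (lexx _) (lexx _).
by rewrite W0 powR0 ?invr_eq0 ?gt_eqF// expr0n/= !mul0r addr0.
Qed.

Section Estimate.
Variables c e : R.
Hypothesis c1 : 1 <= c.
Hypothesis e1 : 1 <= e.
Hypothesis Ebd : embedding_bound E e.
Hypothesis Jbd : smoothing_bound J c.
Hypothesis Hmu : drift_bound a b lambda J mu w1 w2.
Hypothesis cw1 : control a b w1.
Hypothesis cw2 : control a b w2.
Hypothesis lambda2 : 2 <= lambda.
Variables G N : R.
Hypothesis gs_G : `|g s| <= G.
Hypothesis gu_G : `|g u| <= G.
Hypothesis gn_N : `|gn s u| <= N.

Let G0 : 0 <= G. Proof. exact: le_trans gs_G. Qed.
Let N0 : 0 <= N. Proof. exact: le_trans gn_N. Qed.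
Let st : s <= t. Proof. exact: ltW (lt_trans su ut). Qed.
Let v10 : 0 <= w1 s t. Proof. exact: (control_ge0 cw1). Qed.
Let v20 : 0 <= w2 s t. Proof. exact: (control_ge0 cw2). Qed.

(** The estimate at a fixed smoothing scale [eta], which is at least
    the size [wA s t `^ p^-1] of the driver. *)
Lemma delta_remainder_eta (eta : R) : 0 < eta < 1 -> wA s t `^ p^-1 <= eta ->
  `|delta2 gn s u t| <= 24 * (c ^+ 2 * e) *
    (w1 s t * wA s t `^ p^-1 + w2 s t * (eta `^ (2 - lambda) * wA s t `^ p^-1)
     + G * (eta ^+ 2 * wA s t `^ p^-1) + N * (wA s t `^ p^-1 / eta)).
Proof.
move=> eta01 al_eta; have /andP[eta0 eta1] := eta01.
have v1 : w1 s u <= w1 s t by apply: (control_le cw1) => //; exact: ltW.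
have v2 : w2 s u <= w2 s t by apply: (control_le cw2) => //; exact: ltW.
have := delta_remainder_le
  (first_remainder_bound HA Hg c1 e1 Ebd Jbd Hmu sI uI su eta01
    (powR_ge0 _ _) (driver_norm1 (n := 0) isT (lexx _) (ltW su) (ltW ut))
    (driver_norm2 (n := 0) isT (lexx _) (ltW su) (ltW ut))
    gs_G gu_G gn_N v1 v2 v10 v20)
  (increment_bound HA Hg c1 e1 Jbd Hmu sI uI su eta01
    (powR_ge0 _ _) (driver_norm1 (n := 0) isT (lexx _) (ltW su) (ltW ut))
    (driver_norm2 (n := 0) isT (lexx _) (ltW su) (ltW ut))
    gs_G gu_G gn_N v1 v2 v10 v20).
move/le_trans; apply; set B := c ^+ 2 * e.
have B0 : 0 <= B by move: c1 e1 => ? ?; rewrite mulr_ge0 ?exprn_ge0//; lra.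
have -> : eta `^ (1 - lambda) = eta `^ (2 - lambda) / eta.
  rewrite -[X in _ / X]powRr1 ?ltW// -powRB; last first.
    by rewrite (gt_eqF eta0) implybT.
  by congr (_ `^ _); ring.
set P := eta `^ _; have P0 : 0 <= P by exact: powR_ge0.
have etaN0 : eta != 0 by rewrite gt_eqF.
set al := wA s t `^ _; pose x := al / eta.
have al0 : 0 <= al by exact: powR_ge0.
have x0 : 0 <= x by rewrite divr_ge0// ltW.
have x1 : x <= 1 by rewrite ler_pdivrMr// mul1r.
have alE : al = x * eta by rewrite divfK.
rewrite -/x; have xx : x ^+ 2 <= x by rewrite expr2 ler_piMr.
have xk k : x ^+ k.+1 <= x.
  by rewrite exprS; apply: ler_piMr => //; exact: exprn_ile1.
(* Written with [x = al / eta <= 1], every term has a factor [x], so that the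
   higher powers of [x] can be discarded. *)
have -> : al ^+ 2 * (4 * B * (w1 s t + P / eta * w2 s t + G * (eta + al +
    al ^+ 2 / eta) + N / eta ^+ 2)) +
  al * (4 * B * (w1 s t + P * w2 s t + G * (al ^+ 2 + eta ^+ 2 + al * eta) +
    N / eta)) =
  4 * B * (w1 s t * (eta * (x ^+ 2 * eta + x)) + w2 s t * P * eta * (x ^+ 2 + x)
    + G * eta ^+ 3 * (2 * x ^+ 2 + 2 * x ^+ 3 + x ^+ 4 + x)
    + N * (x ^+ 2 + x)) by rewrite alE; field.
have -> : 24 * B * (w1 s t * al + w2 s t * (P * al) + G * (eta ^+ 2 * al) +
    N * x)
  = 4 * B * (w1 s t * (eta * (6 * x)) + w2 s t * P * eta * (6 * x) +
      G * eta ^+ 3 * (6 * x) + N * (6 * x)) by rewrite alE; ring.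
apply: ler_wpM2l; first by rewrite mulr_ge0.
have x2 := xk 1%N; have x3 := xk 2%N; have x4 := xk 3%N.
have x2eta : x ^+ 2 * eta <= x.
  by apply: le_trans (xk 1%N); rewrite ler_piMr ?exprn_ge0// ltW.
have eta0' := ltW eta0.
apply: lerD; [apply: lerD; [apply: lerD|]|].
- by rewrite !ler_wpM2l//; lra.
- by apply: ler_wpM2l; [exact: mulr_ge0 (mulr_ge0 v20 P0) eta0'|lra].
- by apply: ler_wpM2l; [exact: mulr_ge0 G0 (exprn_ge0 3 eta0')|lra].
- by apply: ler_wpM2l => //; lra.
Qed.

(** The choice [eta = Lam * wA s t `^ (p^-1 - kappa)] balances the terms of
    [delta_remainder_eta]. For [kappa = 0] the feedback term is not small
    because of [wA s t], only because of [Lam]. *)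
Lemma delta_remainder_bound (kappa Lam : R) : 0 <= kappa -> 1 <= Lam ->
  0 < wA s t <= 1 -> Lam * wA s t `^ (p^-1 - kappa) < 1 ->
  `|delta2 gn s u t| <= 24 * (c ^+ 2 * e) * Lam ^+ 2 *
    (G * wA s t `^ (3 / p - 2 * kappa) + w1 s t * wA s t `^ p^-1
     + w2 s t * wA s t `^ ((3 - lambda) / p + kappa * (lambda - 2)))
    + 24 * (c ^+ 2 * e) / Lam * N.
Proof.
move=> k0 Lam1 /andP[W0 W1] eta1; set W := wA s t in W0 W1 eta1 *.
have Lam0 : 0 < Lam by exact: lt_le_trans Lam1.
set y := W `^ (p^-1 - kappa) in eta1.
have y0 : 0 < y by rewrite powR_gt0.
have pWN0 r z : (r + z == 0 :> R) ==> (W != 0) by rewrite (gt_eqF W0) implybT.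
have alE : W `^ p^-1 = y * W `^ kappa.
  by rewrite -powRD ?pWN0// subrK.
have Wk1 : W `^ kappa <= 1.
  by rewrite -[leRHS](powRr0 W); apply: ger_powR; rewrite ?W0.
have Wk0 : 0 <= W `^ kappa by exact: powR_ge0.
have al_eta : W `^ p^-1 <= Lam * y.
  rewrite alE mulrC; apply: ler_pM => //; first exact: ltW.
  exact: le_trans Wk1 Lam1.
have eta0 : 0 < Lam * y by rewrite mulr_gt0.
have eta01 : 0 < Lam * y < 1 by rewrite eta0.
apply: le_trans (delta_remainder_eta eta01 al_eta) _; rewrite -/W.
set B := c ^+ 2 * e.
have B0 : 0 <= B by move: c1 e1 => ? ?; rewrite mulr_ge0 ?exprn_ge0//; lra.
have Lam2 : 1 <= Lam ^+ 2 by rewrite exprn_ege1.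
have E3 : (Lam * y) ^+ 2 * W `^ p^-1 = Lam ^+ 2 * W `^ (3 / p - 2 * kappa).
  rewrite exprMn -mulrA; congr (_ * _); rewrite -powR_mulrn ?powR_ge0// -powRrM.
  rewrite -powRD ?pWN0//; congr (_ `^ _).
  by rewrite mulrDl; field; rewrite gt_eqF.
have E4 : W `^ p^-1 / (Lam * y) <= Lam^-1.
  rewrite alE; have -> : y * W `^ kappa / (Lam * y) = Lam^-1 * W `^ kappa.
    by field; rewrite !gt_eqF.
  by rewrite ler_piMr// invr_ge0 ltW.
have E2 : (Lam * y) `^ (2 - lambda) * W `^ p^-1 <=
    W `^ ((3 - lambda) / p + kappa * (lambda - 2)).
  rewrite powRM ?(ltW Lam0) ?(ltW y0)// -powRrM -mulrA -powRD ?pWN0//.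
  rewrite [X in _ * W `^ X](_ : _ =
    (3 - lambda) / p + kappa * (lambda - 2)); last first.
    by field; rewrite gt_eqF.
  rewrite ler_piMl ?powR_ge0// -[leRHS](powRr0 Lam); apply: ler_powR => //.
  by rewrite subr_le0.
rewrite -[24 * B / Lam * N]mulrA -[24 * B * _ * _]mulrA -mulrDr.
apply: ler_wpM2l; first by rewrite mulr_ge0.
rewrite E3.
set Z1 := W `^ p^-1; set Z2 := W `^ ((3 - lambda) / p + _).
have Z10 : 0 <= Z1 by exact: powR_ge0.
have Z20 : 0 <= Z2 by exact: powR_ge0.
have F1 : w1 s t * Z1 <= Lam ^+ 2 * (w1 s t * Z1).
  by rewrite ler_peMl// mulr_ge0.
have F2 : w2 s t * ((Lam * y) `^ (2 - lambda) * Z1) <= Lam ^+ 2 * (w2 s t * Z2).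
  apply: le_trans (ler_wpM2l v20 E2) _.
  by rewrite ler_peMl// mulr_ge0.
have F4 := ler_wpM2l N0 E4.
by rewrite -/Z1 in F4 *; lra.
Qed.

End Estimate.

End DeltaRemainder.

(** * The a priori estimate *)

(** The conditions on the parameters say that every term of [omega_star] is a
    product of powers whose exponents sum to at least one, hence a control. *)
Lemma exponent_conditions {R : realType} (p q kappa lambda : R) :
  let D := (3 - lambda) / p + kappa * (lambda - 2) in
  2 <= p < 3 -> p <= lambda <= 3 ->
  3 * p * lambda / (2 * p + lambda) <= q < 3 ->
  kappa <= 2^-1 * (3 / p - 3 / q) ->
  (if lambda == 2 then 3 / q - 1 - (3 - lambda) / p <= kappa * (lambda - 2)
   else (lambda - 2)^-1 * (3 / q - 1 - (3 - lambda) / p) <= kappa) ->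
  [/\ 0 < q, 1 < 3 / q, 1 <= q / 3 * (3 / p - 2 * kappa),
      1 <= q / 3 + q / (3 * p) & 0 < D /\ 1 <= q / 3 + q / 3 * D].
Proof.
move=> D /andP[p2 p3] /andP[pl l3] /andP[ql q3] kle kge.
have p0 : 0 < p by lra.
have pq : p <= q.
  apply: le_trans ql; rewrite ler_pdivlMr; last by lra.
  by nra.
have q0 : 0 < q by lra.
have th1 : 1 < 3 / q by rewrite ltr_pdivlMr// mul1r.
have qq : q / 3 * (3 / q) = 1 by field; rewrite gt_eqF.
have Dq : 3 / q - 1 <= D.
  rewrite /D; move: kge; case: ifPn => [_|l2]; first by lra.
  have l20 : 0 < lambda - 2 by rewrite subr_gt0 lt_neqAle eq_sym l2; lra.
  by rewrite ler_pdivrMl//; lra.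
have q30 : 0 <= q / 3 by rewrite divr_ge0// ltW.
split=> //.
- by rewrite -[leLHS]qq ler_wpM2l//; lra.
- have -> : q / 3 + q / (3 * p) = q * (p + 1) / (3 * p).
    by field; rewrite gt_eqF.
  by rewrite ler_pdivlMr ?mulr_gt0//; nra.
- split; first by lra.
  by have := ler_wpM2l q30 Dq; rewrite mulrBr qq mulr1; lra.
Qed.

Lemma powRM_root {R : realType} (q x y r : R) : 0 < q -> 0 <= x ->
  (x `^ (q / 3) * y `^ (q / 3 * r)) `^ (3 / q) = x * y `^ r.
Proof.
move=> q0 x0; have qq : q / 3 * (3 / q) = 1 by field; rewrite gt_eqF.
rewrite powRM ?powR_ge0// -!powRrM qq powRr1//.
by rewrite mulrAC qq mul1r.
Qed.

Section Absorption.
Context {R : realType} {p q kappa lambda a b : R} {E : scale R}.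
Context {J : R -> {bounded E 1%N -> E 3%N}} {A : driver E}.
Context {wA w1 w2 : R -> R -> R} {mu : R -> dual (E 3%N)}.
Context {g : R -> dual (E 0%N)} {gn : R -> R -> dual (E 3%N)}.
Hypothesis HA : rough_driver p a b A wA.
Hypothesis Hg : solution a b A mu g gn.
Hypothesis Hgn : V2 (q / 3) a b gn.
Hypothesis p23 : 2 <= p < 3.
Hypothesis q0 : 0 < q.
Hypothesis th1 : 1 < 3 / q.
Variables s0 t0 : R.
Hypothesis s0I : s0 \in `[a, b].
Hypothesis t0I : t0 \in `[a, b].
Hypothesis st0 : s0 < t0.

Let p0 : 0 < p. Proof. by move: p23; lra. Qed.
Let as0 : a <= s0. Proof. by move: s0I; rewrite in_itv/= => /andP[]. Qed.
Let t0b : t0 <= b. Proof. by move: t0I; rewrite in_itv/= => /andP[]. Qed.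
Let subI x : x \in `[s0, t0] -> x \in `[a, b].
Proof. by move: as0 t0b; rewrite !in_itv/=; lra. Qed.
Let s0J : s0 \in `[s0, t0]. Proof. by rewrite in_itv/= lexx ltW. Qed.
Let t0J : t0 \in `[s0, t0]. Proof. by rewrite in_itv/= lexx ltW. Qed.

Let cA : control s0 t0 wA.
Proof. exact: control_sub as0 t0b (driver_control HA).1. Qed.

Let gn_control : exists2 wn, regular_control s0 t0 wn &
  forall s t, s \in `[s0, t0] -> t \in `[s0, t0] -> s <= t ->
    `|gn s t| <= wn s t `^ (3 / q).
Proof.
have [_ _ [wn rwn gn_wn]] := Hgn; exists wn.
  exact: regular_control_sub rwn.
by move=> s t sJ tJ st; rewrite -invf_div gn_wn ?subI.
Qed.

Lemma remainder_eq0 : wA s0 t0 = 0 -> gn s0 t0 = 0.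
Proof.
move=> W0; have [wn rwn gn_wn] := gn_control.
have thN0 : 3 / q != 0 by rewrite gt_eqF// (lt_trans _ th1).
have gn_diag s : s \in `[s0, t0] -> gn s s = 0.
  move=> sJ; apply/eqP; rewrite -normr_le0.
  apply: le_trans (gn_wn _ _ sJ sJ (lexx _)) _.
  by rewrite (control_diag rwn.1)// powR0.
have c0 : control s0 t0 (fun=> fun=> 0 : R) by split=> *; rewrite ?addr0.
have dgn s u t : s \in `[s0, t0] -> t \in `[s0, t0] -> s < u -> u < t ->
    `|delta2 gn s u t| <= 0 `^ (3 / q).
  move=> sJ tJ su ut; have st := ltW (lt_trans su ut).
  rewrite (delta_remainder_eq0 HA Hg p0 (subI sJ) (subI tJ) su ut).
    by rewrite normr0 powR_ge0.
  apply/eqP; rewrite eq_le (control_ge0 cA)// andbT -W0.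
  move: sJ tJ; rewrite !in_itv/= => /andP[s0s _] /andP[_ tt0].
  exact: control_le cA s0J t0J s0s st tt0.
apply/eqP; rewrite -normr_le0.
apply: le_trans (sewing th1 c0 gn_diag dgn rwn gn_wn s0J t0J (ltW st0)) _.
by rewrite powR0// mulr0.
Qed.

Variables c e Lam : R.
Hypothesis c1 : 1 <= c.
Hypothesis e1 : 1 <= e.
Hypothesis Ebd : embedding_bound E e.
Hypothesis Jbd : smoothing_bound J c.
Hypothesis Hmu : drift_bound a b lambda J mu w1 w2.
Hypothesis cw1 : control a b w1.
Hypothesis cw2 : control a b w2.
Hypothesis pl3 : p <= lambda <= 3.
Hypothesis q_bd : 3 * p * lambda / (2 * p + lambda) <= q < 3.
Hypothesis kappa0 : 0 <= kappa.
Hypothesis kappa_le : kappa <= 2^-1 * (3 / p - 3 / q).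
Hypothesis kappa_ge :
  if lambda == 2 then 3 / q - 1 - (3 - lambda) / p <= kappa * (lambda - 2)
  else (lambda - 2)^-1 * (3 / q - 1 - (3 - lambda) / p) <= kappa.

Let K := 24 * (c ^+ 2 * e).
Hypothesis Lam1 : 1 <= Lam.
Hypothesis Lam_big : sewing_const (3 / q) * K * 2 `^ (3 / q) <= Lam.
Hypothesis small1 : wA a b <= 1.
Hypothesis small_eta : forall W, 0 < W -> W <= wA a b ->
  Lam * W `^ (p^-1 - kappa) < 1.

Variable G : R.
Hypothesis g_G : forall r, r \in `[s0, t0] -> `|g r| <= G.

(** The control [omega_star], with the norm of [g] on the whole of
    [[s0, t0]] in the place of [Linfty g s t]. *)
Definition omega_sup (s t : R) : R :=
  G `^ (q / 3) * wA s t `^ (q / 3 * (3 / p - 2 * kappa))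
  + w1 s t `^ (q / 3) * wA s t `^ (q / (3 * p))
  + w2 s t `^ (q / 3)
      * wA s t `^ (q / 3 * ((3 - lambda) / p + kappa * (lambda - 2))).

Let G0 : 0 <= G. Proof. exact: le_trans (g_G s0J). Qed.
Let K0 : 0 <= K.
Proof. by move: c1 e1 => ? ?; rewrite !mulr_ge0 ?exprn_ge0//; lra. Qed.
Let q30 : 0 < q / 3. Proof. exact: divr_gt0. Qed.

Lemma omega_sup_control : control s0 t0 omega_sup.
Proof.
have [_ _ ex1 ex2 [D0 ex3]] :=
  exponent_conditions p23 pl3 q_bd kappa_le kappa_ge.
apply: controlD; first apply: controlD.
- exact: controlZ (powR_ge0 _ _) (control_powR ex1 cA).
- apply: control_powRM ex2 (control_sub as0 t0b cw1) cA => //.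
  by rewrite divr_gt0// mulr_gt0.
- apply: control_powRM ex3 (control_sub as0 t0b cw2) cA => //.
  exact: mulr_gt0.
Qed.

Lemma omega_sup_root s t : s \in `[s0, t0] -> t \in `[s0, t0] -> s <= t ->
  G * wA s t `^ (3 / p - 2 * kappa) + w1 s t * wA s t `^ p^-1
  + w2 s t * wA s t `^ ((3 - lambda) / p + kappa * (lambda - 2))
  <= omega_sup s t `^ (3 / q).
Proof.
move=> sJ tJ st.
have v10 := control_ge0 cw1 (subI sJ) (subI tJ) st.
have v20 := control_ge0 cw2 (subI sJ) (subI tJ) st.
rewrite -(powRM_root (wA s t) (3 / p - 2 * kappa) q0 G0).
rewrite -(powRM_root (wA s t) p^-1 q0 v10).
rewrite -(powRM_root (wA s t) ((3 - lambda) / p + _) q0 v20).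
rewrite /omega_sup; have -> : q / (3 * p) = q / 3 * p^-1.
  by field; rewrite gt_eqF.
set X1 := G `^ _ * _; set X2 := w1 s t `^ _ * _; set X3 := w2 s t `^ _ * _.
have X10 : 0 <= X1 by rewrite mulr_ge0 ?powR_ge0.
have X20 : 0 <= X2 by rewrite mulr_ge0 ?powR_ge0.
have X30 : 0 <= X3 by rewrite mulr_ge0 ?powR_ge0.
apply: le_trans (powR_superadditive (ltW th1) (addr_ge0 X10 X20) X30).
by rewrite lerD2r; exact: powR_superadditive (ltW th1) X10 X20.
Qed.

Lemma remainder_bound : `|gn s0 t0| <=
  2 `^ (3 / q) * (sewing_const (3 / q) * (K * Lam ^+ 2))
    * omega_sup s0 t0 `^ (3 / q).
Proof.
have [wn rwn gn_wn] := gn_control.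
have Lam0 : 0 < Lam by exact: lt_le_trans Lam1.
have K'0 : 0 <= K * Lam ^+ 2 by rewrite mulr_ge0 ?exprn_ge0// ltW.
have eps0 : 0 <= K / Lam by rewrite divr_ge0// ltW.
have small : sewing_const (3 / q) * (K / Lam) <= 2^-1 `^ (3 / q).
  have half : 2^-1 `^ (3 / q) * 2 `^ (3 / q) = 1 :> R.
    by rewrite -powRM ?invr_ge0// mulVf// powR1.
  rewrite mulrA ler_pdivrMr//; set S := sewing_const _ * K.
  have -> : S = 2^-1 `^ (3 / q) * (S * 2 `^ (3 / q)).
    by rewrite mulrCA half mulr1.
  by apply: ler_wpM2l Lam_big; exact: powR_ge0.
apply: (sewing_absorb th1 K'0 eps0 small omega_sup_control rwn gn_wn _ s0J t0J
  (ltW st0)).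
move=> w cw gn_w s u t sJ tJ su ut; have st := lt_trans su ut.
have w0 := control_ge0 cw sJ tJ (ltW st).
have rhs0 : 0 <= K * Lam ^+ 2 * omega_sup s t `^ (3 / q)
    + K / Lam * w s t `^ (3 / q).
  by rewrite addr_ge0// mulr_ge0// powR_ge0.
have [W0|WN0] := eqVneq (wA s t) 0.
  rewrite (delta_remainder_eq0 HA Hg p0 (subI sJ) (subI tJ) su ut W0).
  by rewrite normr0.
have W0 : 0 < wA s t by rewrite lt0r WN0 (control_ge0 cA sJ tJ (ltW st)).
have Wab : wA s t <= wA a b.
  have aI : a \in `[a, b] by rewrite in_itv/= lexx; move: as0 st0 t0b; lra.
  have bI : b \in `[a, b] by rewrite in_itv/= lexx; move: as0 st0 t0b; lra.
  have := subI sJ; have := subI tJ; rewrite !in_itv/=.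
  move=> /andP[_ tb] /andP[sa _].
  exact: control_le (driver_control HA).1 aI bI sa (ltW st) tb.
have W01 : 0 < wA s t <= 1 by rewrite W0 (le_trans Wab).
have uJ : u \in `[s0, t0] by move: sJ tJ; rewrite !in_itv/=; lra.
have gnN : `|gn s u| <= w s t `^ (3 / q).
  apply: le_trans (gn_w s u sJ uJ (ltW su)) _; apply: le_powR.
  - by rewrite ltW// (lt_trans _ th1).
  - exact: control_ge0 cw sJ uJ (ltW su).
  - exact: control_le cw sJ tJ (lexx _) (ltW su) (ltW ut).
have lambda2 : 2 <= lambda by move: p23 pl3; lra.
have := delta_remainder_bound HA Hg p0 (subI sJ) (subI tJ) su ut c1 e1 Ebd Jbd
  Hmu cw1 cw2 lambda2 (g_G sJ) (g_G uJ) gnN kappa0 Lam1 W01 (small_eta W0 Wab).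
rewrite -/K => /le_trans; apply; rewrite lerD2r ler_wpM2l//.
exact: omega_sup_root sJ tJ (ltW st).
Qed.

End Absorption.

Theorem theorem2p9 (R : realType) (q cE cJ : R) :
  exists2 C : R, 0 < C &
  forall p kappa : R,
  exists2 L : R, 0 < L &
  forall (lambda T a b : R) (E : scale R) (J : R -> {bounded E 1%N -> E 3%N})
    (A : driver E) (wA : R -> R -> R)
    (mu : R -> dual (E 3%N)) (w1 w2 : R -> R -> R)
    (g : R -> dual (E 0%N)) (gn : R -> R -> dual (E 3%N)),
  2 <= p < 3 ->
  0 <= a -> a <= b -> b <= T ->
  embedding_bound E cE ->
  smoothing_bound J cJ ->
  rough_driver p a b A wA ->
  finite_1variation a b mu ->
  control a b w1 ->
  control a b w2 ->
  p <= lambda <= 3 ->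
  drift_bound a b lambda J mu w1 w2 ->
  solution a b A mu g gn ->
  V2 (q / 3) a b gn ->
  3 * p * lambda / (2 * p + lambda) <= q < 3 ->
  0 <= kappa < p^-1 ->
  kappa <= 2^-1 * (3 / p - 3 / q) ->
  (if lambda == 2 then 3 / q - 1 - (3 - lambda) / p <= kappa * (lambda - 2)
   else (lambda - 2)^-1 * (3 / q - 1 - (3 - lambda) / p) <= kappa) ->
  wA a b <= L ->
  forall s t : R, s \in `[a, b] -> t \in `[a, b] -> s < t ->
    (`|gn s t|%:E <=
       C%:E * poweR (omega_star p q kappa lambda g wA w1 w2 s t) (3 / q))%E.
Proof.
pose c := 1 + `|cJ|; pose e := 1 + `|cE|; pose K := 24 * (c ^+ 2 * e).
pose Lam := Num.max 1 (sewing_const (3 / q) * K * 2 `^ (3 / q)).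
(* The maximum with 1 keeps [C] positive also for those [q] that violate the
   hypotheses, where the sewing constant may be negative. *)
pose C := Num.max 1
  (2 `^ (3 / q) * (sewing_const (3 / q) * (K * Lam ^+ 2))).
have C0 : 0 < C by rewrite lt_max ltr01.
have Lam1 : 1 <= Lam by rewrite le_max lexx.
exists C => // p kappa.
(* The bound on [wA] under which [Lam * wA s t `^ (p^-1 - kappa) <= 1 / 2]. *)
exists ((2 * Lam) `^ (- (p^-1 - kappa)^-1)).
  by rewrite powR_gt0//; lra.
move=> lambda T a b E J A wA mu w1 w2 g gn p23 _ _ _ EcE JcJ HA _ cw1 cw2 pl3
  Hmu Hg Hgn q_bd /andP[kappa0 kappa_p] kappa_le kappa_ge wA_L s t sI tI st.
have [q0 th1 ex1 ex2 [D0 ex3]] :=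
  exponent_conditions p23 pl3 q_bd kappa_le kappa_ge.
have th0 : 0 < 3 / q by rewrite divr_gt0.
have r0 : 0 < p^-1 - kappa by rewrite subr_gt0.
have Lam2 : 1 <= 2 * Lam by lra.
have rhs0 : (0 <= C%:E *
    poweR (omega_star p q kappa lambda g wA w1 w2 s t) (3 / q))%E.
  by rewrite mule_ge0 ?poweR_ge0// lee_fin ltW.
have [W0|WN0] := eqVneq (wA s t) 0.
  by rewrite (remainder_eq0 HA Hg Hgn p23 th1 sI tI st W0) normr0.
have W0 : 0 < wA s t.
  by rewrite lt0r WN0 (control_ge0 (driver_control HA).1 sI tI (ltW st)).
case HG : (Linfty g s t) => [G| |]; last 2 first.
(* If [g] is unbounded on [s, t], so is the right-hand side, because [wA s t]
   is positive. *)
- have q3N0 : q / 3 != 0 by rewrite gt_eqF// divr_gt0.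
  have -> : omega_star p q kappa lambda g wA w1 w2 s t = +oo%E.
    by rewrite /omega_star HG poweRyr// gt0_mulye ?lte_fin ?powR_gt0//
      -addeA addye.
  by rewrite poweRyr ?gt_eqF// gt0_muley ?lte_fin// leey.
- have : (`|g s|%:E <= Linfty g s t)%E.
    apply: ereal_sup_ubound; exists s => //=.
    by rewrite in_itv/= lexx ltW.
  by rewrite HG.
have g_G r : r \in `[s, t] -> `|g r| <= G.
  move=> rJ; rewrite -lee_fin -HG; apply: ereal_sup_ubound.
  by exists r.
have c1 : 1 <= c by rewrite lerDl.
have e1 : 1 <= e by rewrite lerDl.
have Ee : embedding_bound E e.
  by apply: embedding_bound_le EcE; have := ler_norm cE; rewrite /e; lra.
have Jc : smoothing_bound J c.
  by apply: smoothing_bound_le JcJ; have := ler_norm cJ; rewrite /c; lra.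
have Lam_big : sewing_const (3 / q) * K * 2 `^ (3 / q) <= Lam.
  by rewrite le_max lexx orbT.
have small1 : wA a b <= 1.
  apply: le_trans wA_L _; rewrite -[leRHS](powRr0 (2 * Lam)).
  by apply: ler_powR => //; rewrite oppr_le0 invr_ge0 ltW.
have small_eta W : 0 < W -> W <= wA a b -> Lam * W `^ (p^-1 - kappa) < 1.
  move=> W0' Wab; have WL := le_trans Wab wA_L.
  have := le_powR (ltW r0) (ltW W0') WL.
  rewrite -powRrM mulNr mulVf ?gt_eqF// powR_inv1; last by lra.
  move=> H; have := ler_wpM2l (le_trans ler01 Lam1) H.
  have -> : Lam * (2 * Lam)^-1 = 2^-1 by field; rewrite gt_eqF//; lra.
  by lra.
have bound := remainder_bound HA Hg Hgn p23 q0 th1 sI tI st c1 e1 Ee Jc Hmu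
  cw1 cw2 pl3 q_bd kappa0 kappa_le kappa_ge Lam1 Lam_big small1 small_eta g_G.
rewrite /omega_star HG -EFinM lee_fin; apply: le_trans bound _.
by rewrite ler_wpM2r ?powR_ge0// le_max lexx orbT.
Qed.
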